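(* Let $N\ge0$, $\mathbf a_N=(a(0),\dots,a(N))\in\mathbb C^{N+1}$, $P_1,P_2>0$, $0<\varepsilon<1$, let $v,u,g_1$ be given spectral densities with $v,u$ bounded, and $D=D_v^u\times D_\varepsilon$ with $$D_v^u=\left\{f: v\le f\le u,\ \frac1{2\pi}\int_{-\pi}^\pi f\,d\lambda\le P_1\right\},\qquad D_\varepsilon=\left\{g: g=(1-\varepsilon)g_1+\varepsilon w,\ \frac1{2\pi}\int_{-\pi}^\pi g\,d\lambda\le P_2\right\},$$ $w$ being an arbitrary (unknown) spectral density. Let $f_0\in D_v^u$, $g_0\in D_\varepsilon$ satisfy $\int_{-\pi}^\pi(f_0+g_0)^{-1}d\lambda<\infty$, put $C_N^0(e^{i\lambda})=\sum_{j=0}^N((\mathbf B_N^0)^{-1}\mathbf R_N^0\mathbf a_N)_je^{ij\lambda}$, and let the functions $$h_f(f_0,g_0)=\frac{|A_N(e^{i\lambda})g_0(\lambda)+C_N^0(e^{i\lambda})|^2}{(f_0(\lambda)+g_0(\lambda))^2},\qquad h_g(f_0,g_0)=\frac{|A_N(e^{i\lambda})f_0(\lambda)-C_N^0(e^{i\lambda})|^2}{(f_0(\lambda)+g_0(\lambda))^2}$$ be bounded. Suppose that $$|A_N(e^{i\lambda})g_0(\lambda)+C_N^0(e^{i\lambda})|=(f_0(\lambda)+g_0(\lambda))(\gamma_1(\lambda)+\gamma_2(\lambda)+\alpha_1^{-1}),$$ $$|A_N(e^{i\lambda})f_0(\lambda)-C_N^0(e^{i\lambda})|=(f_0(\lambda)+g_0(\lambda))(\varphi(\lambda)+\alpha_2^{-1}),$$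 where $\alpha_1,\alpha_2$ are positive constants, $\gamma_1\le0$ with $\gamma_1(\lambda)=0$ where $f_0(\lambda)>v(\lambda)$, $\gamma_2\ge0$ with $\gamma_2(\lambda)=0$ where $f_0(\lambda)<u(\lambda)$, and $\varphi\le0$ with $\varphi(\lambda)=0$ where $g_0(\lambda)>(1-\varepsilon)g_1(\lambda)$; and suppose that $(f_0,g_0)$ determines a solution to the optimization problem $$\max_{(f,g)\in D}\left(\langle\mathbf R_N\mathbf a_N,\mathbf B_N^{-1}\mathbf R_N\mathbf a_N\rangle+\langle\mathbf Q_N\mathbf a_N,\mathbf a_N\rangle\right)=\langle\mathbf R_N^0\mathbf a_N,(\mathbf B_N^0)^{-1}\mathbf R_N^0\mathbf a_N\rangle+\langle\mathbf Q_N^0\mathbf a_N,\mathbf a_N\rangle .$$ Then $f_0,g_0$ are least favourable in $D_v^u\times D_\varepsilon$ for the optimal linear estimation of $A_N\xi=\sum_{j=0}^Na(j)\xi(j)$ from observations of $\xi(j)+\eta(j)$, $j\in\mathbb Z\setminus\{0,\dots,N\}$, and $$h^0(e^{i\lambda})=\frac{A_N(e^{i\lambda})f_0(\lambda)-C_N^0(e^{i\lambda})}{f_0(\lambda)+g_0(\lambda)}$$ is the minimax-robust spectral characteristic of the optimal linear estimate of $A_N\xi$.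
   Context: $\xi,\eta$ are zero mean uncorrelated wide sense stationary sequences with spectral densities $f,g$ ($E\xi(j+k)\overline{\xi(j)}=\frac1{2\pi}\int e^{ik\lambda}f\,d\lambda$, etc.). $A_N(e^{i\lambda})=\sum_{j=0}^Na(j)e^{ij\lambda}$, $\langle x,y\rangle=\sum_{k=0}^Nx_k\overline{y_k}$. $\mathbf B_N,\mathbf R_N,\mathbf Q_N$ are the $(N+1)\times(N+1)$ matrices with entries $\frac1{2\pi}\int_{-\pi}^\pi e^{-i(j-k)\lambda}\psi(\lambda)d\lambda$, $j,k=0,\dots,N$, with $\psi=\frac1{f+g}$, $\frac f{f+g}$, $\frac{fg}{f+g}$ respectively; superscript $0$ refers to $(f_0,g_0)$. Wherever $\mathbf B_N^{-1}$ is used, $(f,g)$ is understood to satisfy the minimality condition $\int(f+g)^{-1}d\lambda<\infty$. $L_2^N(f+g)$ is the closed span of $\{e^{ij\lambda}:j\in\mathbb Z\setminus\{0,\dots,N\}\}$ in $L_2(f+g)$; for $h\in L_2^N(f+g)$, $\Delta(h;f,g)=\frac1{2\pi}\int|A_N-h|^2f\,d\lambda+\frac1{2\pi}\int|h|^2g\,d\lambda$, and $h(f,g)$ is its minimizer. $(f_0,g_0)\in D$ is least favourable if $\Delta(h(f_0,g_0);f_0,g_0)=\max_{(f,g)\in D}\Delta(h(f,g);f,g)$. $h^0$ is minimax-robust if $h^0\in H_D=\bigcap_{(f,g)\in D}L_2^N(f+g)$ and $\min_{h\in H_D}\max_{(f,g)\in D}\Delta(h;f,g)=\sup_{(f,g)\in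 D}\Delta(h^0;f,g)$. *)

(* Defs.v *)
From mathcomp Require Import all_boot all_order all_algebra.
From mathcomp Require Import complex.
From mathcomp Require Import all_classical all_reals all_analysis.

Set Implicit Arguments.
Unset Strict Implicit.
Unset Printing Implicit Defensive.

Import Order.TTheory GRing.Theory Num.Theory.
Import numFieldNormedType.Exports.

Local Open Scope classical_set_scope.
Local Open Scope ring_scope.
Local Open Scope complex_scope.

Section Definitions.
Context {R : realType}.
Implicit Types (f g u v w : R -> R) (h : R -> R[i]).

Definition circle : set R := `[- pi, pi].

(* Functions of the frequency are total functions on R of which only the values
   on [-pi, pi] matter; relations between them hold Lebesgue-almost everywhere
   there, in accordance with spectral densities being classes of functions. *)
Definition ae_circle (P : R -> Prop) : Prop :=
  {ae @lebesgue_measure R, forall x, circle x -> P x}.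

Definition ae_bounded (F : R -> R) : Prop :=
  exists M : R, ae_circle (fun x => `|F x| <= M).

Definition mean (F : R -> R) : R :=
  (pi *+ 2)^-1 * \int[@lebesgue_measure R]_(x in circle) F x.

Definition emean (F : R -> R) : \bar R :=
  ((pi *+ 2)^-1%:E * \int[@lebesgue_measure R]_(x in circle) (F x)%:E)%E.

Definition cmean (F : R -> R[i]) : R[i] :=
  mean (fun x => complex.Re (F x)) +i* mean (fun x => complex.Im (F x)).

Definition cabs (z : R[i]) : R := complex.Re `|z|.

Definition expi (k : int) (x : R) : R[i] := cos (k%:~R * x) +i* sin (k%:~R * x).

Definition spectral_density f : Prop :=
  (forall x, circle x -> 0 <= f x) /\
  (@lebesgue_measure R).-integrable circle (EFin \o f).

(* The inverse is the one of extended reals, for which 0^-1 = +oo: the condition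
   thus forces f + g > 0 almost everywhere. *)
Definition minimality f g : Prop :=
  (\int[@lebesgue_measure R]_(x in circle) ((f x + g x)%:E)^-1 < +oo)%E.

Section Problem.
Variable N : nat.
Implicit Types a c : 'cV[R[i]]_N.+1.

Definition trig_poly c (x : R) : R[i] := \sum_(j < N.+1) c j 0 * expi j%:Z x.

Definition inner (x y : 'cV[R[i]]_N.+1) : R[i] :=
  \sum_(k < N.+1) x k 0 * conjc (y k 0).

Definition fourier_mx (psi : R -> R) : 'M[R[i]]_N.+1 :=
  \matrix_(j, k) cmean (fun x => expi (- (j%:Z - k%:Z)) x * (psi x)%:C).

Definition Bmx f g := fourier_mx (fun x => (f x + g x)^-1).
Definition Rmx f g := fourier_mx (fun x => f x / (f x + g x)).
Definition Qmx f g := fourier_mx (fun x => f x * g x / (f x + g x)).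

(* It is real; in the maximum over D, [<=] is the partial order of R[i]. *)
Definition objective a f g : R[i] :=
  inner (Rmx f g *m a) (invmx (Bmx f g) *m (Rmx f g *m a)) +
  inner (Qmx f g *m a) a.

Definition Cfun a f g : R -> R[i] :=
  trig_poly (invmx (Bmx f g) *m (Rmx f g *m a)).

Definition observed_poly (p : R -> R[i]) : Prop :=
  exists (s : seq int) (c : int -> R[i]),
    all (fun j => ~~ (0 <= j <= N%:Z)) s /\
    p = (fun x => \sum_(j <- s) c j * expi j x).

(* Elements of L_2^N(f+g) are represented by functions, so that membership for
   several (f, g) at once makes sense. *)
Definition L2N f g : set (R -> R[i]) := [set h |
  [/\ measurable_fun circle (fun x => complex.Re (h x)),
      measurable_fun circle (fun x => complex.Im (h x)),
      (emean (fun x => (cabs (h x) ^+ 2 * (f x + g x))%R) < +oo)%E &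
      forall e : R, 0 < e -> exists2 p, observed_poly p &
        (emean (fun x => (cabs (h x - p x) ^+ 2 * (f x + g x))%R) < e%:E)%E]].

Definition Delta a h f g : \bar R :=
  (emean (fun x => (cabs (trig_poly a x - h x) ^+ 2 * f x)%R) +
   emean (fun x => (cabs (h x) ^+ 2 * g x)%R))%E.

Definition is_max {d : Order.disp_t} {T : porderType d} (S : set T) (m : T) :=
  S m /\ ubound S m.

Definition is_min {d : Order.disp_t} {T : porderType d} (S : set T) (m : T) :=
  S m /\ lbound S m.

(* "h = h(f,g)": the minimizer of Delta over L_2^N(f+g), which exists and is
   unique up to f+g-almost everywhere equality. *)
Definition optimal_char a f g h : Prop :=
  L2N f g h /\ is_min [set Delta a h' f g | h' in L2N f g] (Delta a h f g).

Definition least_favourable a (D : set ((R -> R) * (R -> R))) f0 g0 : Prop :=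
  D (f0, g0) /\
  exists2 h0, optimal_char a f0 g0 h0 &
    is_max [set d | exists f g h,
              [/\ D (f, g), optimal_char a f g h & d = Delta a h f g]]
           (Delta a h0 f0 g0).

Definition HD (D : set ((R -> R) * (R -> R))) : set (R -> R[i]) :=
  \bigcap_(fg in D) L2N fg.1 fg.2.

(* The inner maximum need not be attained for an arbitrary h and is read as a
   supremum in the extended reals. *)
Definition worst_error a (D : set ((R -> R) * (R -> R))) h : \bar R :=
  ereal_sup [set Delta a h fg.1 fg.2 | fg in D].

Definition minimax_robust a (D : set ((R -> R) * (R -> R))) h0 : Prop :=
  HD D h0 /\ is_min [set worst_error a D h | h in HD D] (worst_error a D h0).

End Problem.

Definition Dvu v u (P1 : R) : set (R -> R) := [set f |
  [/\ spectral_density f, ae_circle (fun x => v x <= f x <= u x) &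
      mean f <= P1]].

Definition Deps (eps : R) (g1 : R -> R) (P2 : R) : set (R -> R) := [set g |
  [/\ spectral_density g,
      exists2 w, spectral_density w &
        ae_circle (fun x => g x = (1 - eps) * g1 x + eps * w x) &
      mean g <= P2]].

End Definitions.

(* Main.v *)
Require Import Defs.
From mathcomp Require Import all_boot all_order all_algebra.
From mathcomp Require Import complex.
From mathcomp Require Import all_classical all_reals all_analysis.
From mathcomp Require Import measurable_realfun ring lra.
Import Order.TTheory GRing.Theory Num.Theory.
Import numFieldNormedType.Exports.
Local Open Scope classical_set_scope.
Local Open Scope ring_scope.
Local Open Scope complex_scope.

(** Write [m] for the error of [h0] at [(f0, g0)].  By the normal equations [m] is
    the value of the objective at [(f0, g0)], and
    [Delta(k; f0, g0) = m + |k - h0|^2] in L2(f0 + g0) for every square integrable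
    [k] whose Fourier coefficients 0, ..., N vanish.  For [(f, g)] in the convex set
    [D] let [k] be optimal for [(1 - t) (f0, g0) + t (f, g)], where the objective is
    at most [m].  As the error is affine in the densities, [Delta(k; f, g) <= m] and
    [|k - h0|^2 <= t m / (1 - t)]; letting [t] tend to 0, with a cutoff where [f + g]
    is not dominated by [f0 + g0], gives [Delta(h0; f, g) <= m].  So [(f0, g0)] and
    [h0] form a saddle point.  That [h0] lies in [L2N(f, g)] for every [(f, g)] in
    [D] holds because it is bounded and trigonometric polynomials are dense in every
    weighted L2 space of the circle, by the pi-lambda theorem applied to rays. *)

Set Implicit Arguments.
Unset Strict Implicit.
Unset Printing Implicit Defensive.

(** * Means over the circle *)

(** A member [(f, g)] of [D] need not satisfy the minimality condition, so maximality of the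
    objective gives nothing at [(f, g)] itself; the points of the segment with [0 < t < 1] do
    satisfy it, their total density being at least [(1 - t) (f0 + g0)]. The cutoff is forced by a
    mismatch of weights: [|k - h0|^2] is controlled in the weight [f0 + g0], while errors at
    [(f, g)] carry the weight [f + g], and the ratio of the two may be unbounded. Replacing [k] by
    [h0] costs the factors [1 + s] and [1 + 1/s] of a weighted square inequality; with [t = s^2] the
    total loss is of order [s] for each fixed cutoff. In the density argument the obstacle is that
    an approximating polynomial may contain the forbidden frequencies [0, ..., N], and the weight
    [f + g] alone may be too small to bound their coefficients. *)

Section Means.
Context {R : realType}.
Implicit Types (F G : R -> R).
Local Notation mu := (@lebesgue_measure R).

(* Typeclass resolution does not find this instance for Lebesgue measure. *)
#[local] Instance ae_filter_lebesgue : Filter (almost_everywhere mu) :=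
  ae_filter_ringOfSetsType mu.

Definition measc F := measurable_fun (@circle R) F.
Definition intg F := mu.-integrable circle (EFin \o F).

Lemma measurable_circle : measurable (@circle R : set (measurableTypeR R)).
Proof. exact: measurable_itv. Qed.
#[local] Hint Resolve measurable_circle : core.

Lemma pi2_gt0 : 0 < (pi : R) *+ 2.
Proof. by rewrite pmulrn_lgt0 // pi_gt0. Qed.

Lemma mu_circle : mu circle = ((pi : R) *+ 2)%:E.
Proof.
rewrite /circle lebesgue_measure_itv /= lte_fin ifT; last first.
  by rewrite gtrN ?pi_gt0.
by rewrite -EFinD opprK mulr2n.
Qed.

Lemma ae_circle_all (P : R -> Prop) : (forall x, circle x -> P x) -> ae_circle P.
Proof. by move=> h; apply: aeW. Qed.

Lemma ae_circle_imp (P Q : R -> Prop) :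
  (forall x, circle x -> P x -> Q x) -> ae_circle P -> ae_circle Q.
Proof. by rewrite /ae_circle => h; apply: filterS => x hx cx; apply: h => //; exact: hx. Qed.

Lemma ae_circle_imp2 (P1 P2 Q : R -> Prop) :
  (forall x, circle x -> P1 x -> P2 x -> Q x) ->
  ae_circle P1 -> ae_circle P2 -> ae_circle Q.
Proof.
by rewrite /ae_circle => h; apply: filterS2 => x h1 h2 cx; apply: h => //; [exact: h1|exact: h2].
Qed.

Lemma intg_measc F : intg F -> measc F.
Proof. by move=> /measurable_int /measurable_EFinP. Qed.

Lemma intg_cst (c : R) : intg (fun=> c).
Proof.
apply/integrableP; split; first exact/measurable_EFinP/measurable_cst.
rewrite /= (_ : (fun _ => _) = cst `|c|%:E) // integral_cst //.
by rewrite [X in (_ * X)%E]mu_circle -EFinM ltry.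
Qed.

Lemma intgD F G : intg F -> intg G -> intg (fun x => F x + G x).
Proof.
move=> iF iG; have := integrableD measurable_circle iF iG.
by apply: eq_integrable => // x _.
Qed.

Lemma intgZ (c : R) F : intg F -> intg (fun x => c * F x).
Proof.
move=> iF; have := integrableZl measurable_circle c iF.
by apply: eq_integrable => // x _.
Qed.

Lemma intgN F : intg F -> intg (fun x => - F x).
Proof.
move=> iF; have := intgZ (-1) iF.
by rewrite (_ : (fun x => _ * _) = (fun x => - F x)) //; apply/funext => x; rewrite mulN1r.
Qed.

Lemma intgB F G : intg F -> intg G -> intg (fun x => F x - G x).
Proof. by move=> iF iG; apply: intgD => //; exact: intgN. Qed.

Lemma intg_abs F : intg F -> intg (fun x => `|F x|).
Proof.
by move=> /integrable_abse; apply: eq_integrable => // x _.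
Qed.

Lemma intg_le F G : measc F -> ae_circle (fun x => `|F x| <= G x) -> intg G -> intg F.
Proof.
move=> mF FG iG; apply/integrableP; split; first exact/measurable_EFinP.
have iG' := intg_abs iG; have mG := intg_measc iG.
apply: le_lt_trans (integrable_lty measurable_circle iG').
apply: ae_ge0_le_integral => //=.
- by apply/measurable_EFinP; apply: measurableT_comp.
- by apply/measurable_EFinP; apply: measurableT_comp.
- apply: ae_circle_imp FG => x _ h; rewrite lee_fin.
  exact: (le_trans h (ler_norm _)).
Qed.

Lemma meanD F G : intg F -> intg G ->
  mean (fun x => F x + G x) = mean F + mean G.
Proof. by move=> iF iG; rewrite /mean RintegralD // mulrDr. Qed.

Lemma meanZ (c : R) F : intg F -> mean (fun x => c * F x) = c * mean F.
Proof. by move=> iF; rewrite /mean RintegralZl // mulrCA. Qed.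

Lemma meanN F : intg F -> mean (fun x => - F x) = - mean F.
Proof.
move=> iF; rewrite -mulN1r -meanZ //; congr mean.
by apply/funext => x; rewrite mulN1r.
Qed.

Lemma meanB F G : intg F -> intg G ->
  mean (fun x => F x - G x) = mean F - mean G.
Proof. by move=> iF iG; rewrite meanD ?meanN //; exact: intgN. Qed.

Lemma mean_cst (c : R) : mean (fun=> c) = c.
Proof.
rewrite /mean Rintegral_cst //.
have -> : fine (mu circle) = (pi : R) *+ 2 by rewrite [X in fine X]mu_circle.
by rewrite mulrC mulfK // gt_eqF // pi2_gt0.
Qed.

Lemma mean_eq F G : measc F -> measc G ->
  ae_circle (fun x => F x = G x) -> mean F = mean G.
Proof.
move=> mF mG FG; rewrite /mean /Rintegral; congr (_ * fine _).
apply: ae_eq_integral => //; try exact/measurable_EFinP.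
by move: FG; rewrite /ae_circle; apply: filterS => x h cx; rewrite /= h.
Qed.

Lemma mean_ge0 F : intg F -> ae_circle (fun x => 0 <= F x) -> 0 <= mean F.
Proof.
move=> iF F0; rewrite (@mean_eq F (fun x => `|F x|)).
- apply: mulr_ge0; first by rewrite invr_ge0 ltW // pi2_gt0.
  exact: Rintegral_ge0.
- exact: intg_measc.
- exact: intg_measc (intg_abs iF).
- by apply: ae_circle_imp F0 => x _ h; rewrite ger0_norm.
Qed.

Lemma mean_le F G : intg F -> intg G ->
  ae_circle (fun x => F x <= G x) -> mean F <= mean G.
Proof.
move=> iF iG FG; rewrite -subr_ge0 -meanB //; apply: mean_ge0; first exact: intgB.
by apply: ae_circle_imp FG => x _; rewrite subr_ge0.
Qed.

Lemma mean_norm F : intg F -> `|mean F| <= mean (fun x => `|F x|).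
Proof.
move=> iF; have iF' := intg_abs iF; rewrite ler_norml -meanN //.
apply/andP; split; apply: mean_le => //; try exact: intgN.
  by apply: ae_circle_all => x _; rewrite lerNl -normrN ler_norm.
by apply: ae_circle_all => x _; rewrite ler_norm.
Qed.

Lemma emean_intg F : intg F -> emean F = (mean F)%:E.
Proof.
move=> iF; rewrite /emean /mean /Rintegral EFinM fineK //.
exact: (integrable_fin_num measurable_circle iF).
Qed.

Lemma emean_ltyP F : measc F -> (forall x, circle x -> 0 <= F x) ->
  (emean F < +oo)%E -> intg F.
Proof.
move=> mF F0 h; apply/integrableP; split; first exact/measurable_EFinP.
have e : (\int[mu]_(x in circle) `|(EFin \o F) x| =
          \int[mu]_(x in circle) (F x)%:E)%E.
  by apply: eq_integral => x; rewrite inE => cx; rewrite /= ger0_norm // F0.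
rewrite e ltey; apply: contraTneq h => e'.
by rewrite /emean e' gt0_muley // lte_fin invr_gt0 pi2_gt0.
Qed.

Lemma mean_eq0 F : intg F -> ae_circle (fun x => 0 <= F x) -> mean F = 0 ->
  ae_circle (fun x => F x = 0).
Proof.
move=> iF F0 m0; have iF' := intg_abs iF.
have : (\int[mu]_(x in circle) `|(EFin \o F) x| = 0)%E.
  have -> : (\int[mu]_(x in circle) `|(EFin \o F) x| =
            (\int[mu]_(x in circle) `|F x|)%:E)%E.
    by rewrite /Rintegral fineK //; exact: (integrable_fin_num measurable_circle iF').
  have : mean (fun x => `|F x|) = 0.
    rewrite -m0; apply: mean_eq; [exact: intg_measc|exact: intg_measc|].
    by apply: ae_circle_imp F0 => x _ h; rewrite ger0_norm.
  by move/eqP; rewrite /mean mulf_eq0 invr_eq0 gt_eqF ?pi2_gt0 //= => /eqP ->.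
move=> /(ae_eq_integral_abs mu measurable_circle (measurable_int _ iF)) h.
rewrite /ae_circle; by apply: filterS h => x hx cx; have := hx cx => -[].
Qed.

(** The variance [mean ((F - mean F)^2)] is nonnegative, and [mean] has total mass one. *)
Lemma sqr_mean_le F : intg F -> intg (fun x => F x ^+ 2) ->
  mean F ^+ 2 <= mean (fun x => F x ^+ 2).
Proof.
move=> iF iF2; have iL := intgZ (mean F *+ 2) iF.
have : 0 <= mean (fun x => F x ^+ 2 - (mean F *+ 2) * F x + mean F ^+ 2).
  apply: mean_ge0; first by apply: intgD; [apply: intgB|apply: intg_cst].
  apply: ae_circle_all => x _; rewrite [leRHS](_ : _ = (F x - mean F) ^+ 2) ?sqr_ge0 //.
  by rewrite mulr2n; ring.
rewrite meanD ?mean_cst ?meanB ?meanZ //; [|exact: intgB iF2 iL|exact: intg_cst].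
by rewrite mulr2n; lra.
Qed.

Lemma mean_dominated (Fn : nat -> R -> R) F G :
  (forall n, measc (Fn n)) -> measc F -> intg G ->
  ae_circle (fun x => (fun n => Fn n x) @ \oo --> F x) ->
  ae_circle (fun x => forall n, `|Fn n x| <= G x) ->
  (fun n => mean (Fn n)) @ \oo --> mean F.
Proof.
move=> mFn mF iG hF hG.
have iFn n : intg (Fn n) by apply: intg_le iG => //; apply: ae_circle_imp hG.
have [] := @dominated_convergence _ _ _ mu circle measurable_circle
  (fun n => EFin \o Fn n) (EFin \o F) (EFin \o G).
- by move=> n; apply/measurable_EFinP; exact: mFn.
- by apply/measurable_EFinP; exact: mF.
- move: hF; rewrite /ae_circle; apply: filterS => x h cx; apply: cvg_EFin; [exact: nearW|exact: h].
- exact: iG.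
- move: hG; rewrite /ae_circle; apply: filterS => x h n cx /=; rewrite lee_fin; exact: h.
move=> iF _ cv; rewrite /mean; apply: cvgM; first exact: cvg_cst.
apply: fine_cvg.
by rewrite fineK //; exact: (integrable_fin_num measurable_circle iF).
Qed.

End Means.
#[export] Hint Resolve measurable_circle : core.

(** * Complex-valued functions through their real and imaginary parts *)

Section ComplexMeans.
Context {R : realType}.
Implicit Types (F G : R -> R) (h k : R -> R[i]) (z w : R[i]).
Local Notation Re := complex.Re.
Local Notation Im := complex.Im.

Lemma ReM z w : Re (z * w) = Re z * Re w - Im z * Im w.
Proof. by case: z; case: w. Qed.
Lemma ImM z w : Im (z * w) = Re z * Im w + Im z * Re w.
Proof. by case: z => a b; case: w => c d. Qed.
Lemma ReD z w : Re (z + w) = Re z + Re w.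
Proof. by case: z; case: w. Qed.
Lemma ImD z w : Im (z + w) = Im z + Im w.
Proof. by case: z; case: w. Qed.
Lemma ReN z : Re (- z) = - Re z.
Proof. by case: z. Qed.
Lemma ImN z : Im (- z) = - Im z.
Proof. by case: z. Qed.
Lemma ReJ z : Re (conjc z) = Re z.
Proof. by case: z. Qed.
Lemma ImJ z : Im (conjc z) = - Im z.
Proof. by case: z. Qed.
Definition ReImE := (ReD, ImD, ReN, ImN, ReM, ImM, ReJ, ImJ).

Lemma complex_eq z w : Re z = Re w -> Im z = Im w -> z = w.
Proof. by case: z; case: w => ? ? ? ? /= -> ->. Qed.

Lemma cabs2 z : cabs z ^+ 2 = Re z ^+ 2 + Im z ^+ 2.
Proof. by case: z => a b; rewrite /cabs normc_def /= sqr_sqrtr // addr_ge0 ?sqr_ge0. Qed.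

Lemma cabs2M z w : cabs (z * w) ^+ 2 = cabs z ^+ 2 * cabs w ^+ 2.
Proof. by rewrite !cabs2 !ReImE; ring. Qed.

Lemma cabs2D_le z w : cabs (z + w) ^+ 2 <= cabs z ^+ 2 *+ 2 + cabs w ^+ 2 *+ 2.
Proof.
rewrite !cabs2 !ReImE -subr_ge0.
have h1 := sqr_ge0 (Re z - Re w); have h2 := sqr_ge0 (Im z - Im w).
rewrite [leRHS](_ : _ = (Re z - Re w) ^+ 2 + (Im z - Im w) ^+ 2) ?addr_ge0 //.
by rewrite !mulr2n; ring.
Qed.

Lemma cabs2_eq0 z : cabs z ^+ 2 = 0 -> z = 0.
Proof.
rewrite cabs2 => /eqP; rewrite paddr_eq0 ?sqr_ge0 // !sqrf_eq0 => /andP[/eqP a /eqP b].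
exact: complex_eq.
Qed.

Definition cmeasc h := measc (fun x => Re (h x)) /\ measc (fun x => Im (h x)).
Definition cintg h := intg (fun x => Re (h x)) /\ intg (fun x => Im (h x)).

Lemma measc_cst (c : R) : measc (fun=> c).
Proof. exact: measurable_cst. Qed.
Lemma measc_id : measc (@id R).
Proof. exact: measurable_id. Qed.
Lemma measc_comp (f : R -> R) F : measurable_fun setT f -> measc F -> measc (fun x => f (F x)).
Proof. by move=> mf mF; apply: measurableT_comp. Qed.
Lemma measc_cont (f : R -> R) F : continuous f -> measc F -> measc (fun x => f (F x)).
Proof. by move=> cf; apply: measc_comp; exact: continuous_measurable_fun. Qed.
Lemma meascD F G : measc F -> measc G -> measc (fun x => F x + G x).
Proof. by move=> mF mG; apply: measurable_funD. Qed.
Lemma meascN F : measc F -> measc (fun x => - F x).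
Proof. by move=> mF; apply: measurableT_comp. Qed.
Lemma meascB F G : measc F -> measc G -> measc (fun x => F x - G x).
Proof. by move=> mF mG; apply: measurable_funB. Qed.
Lemma meascM F G : measc F -> measc G -> measc (fun x => F x * G x).
Proof. by move=> mF mG; apply: measurable_funM. Qed.
Lemma meascX F n : measc F -> measc (fun x => F x ^+ n).
Proof. by move=> mF; apply: measurable_funX. Qed.
Lemma measurable_invr : measurable_fun setT (@GRing.inv R).
Proof.
rewrite -(setvU [set 0]); apply/measurable_funU => //.
  exact: measurableC.
split; last exact: measurable_fun_set1.
apply: open_continuous_measurable_fun; first by apply: closed_openC; exact: closed_eq.
by move=> x; rewrite inE /= => /eqP; exact: inv_continuous.
Qed.
Lemma meascV F : measc F -> measc (fun x => (F x)^-1).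
Proof. by apply: measc_comp; exact: measurable_invr. Qed.

Lemma cmeasc_cst z : cmeasc (fun=> z).
Proof. by split; exact: measc_cst. Qed.
Lemma cmeasc_real F : measc F -> cmeasc (fun x => (F x)%:C).
Proof. by split => //; exact: measc_cst. Qed.
Lemma cmeascD h k : cmeasc h -> cmeasc k -> cmeasc (fun x => h x + k x).
Proof.
move=> [? ?] [? ?]; split; [under eq_fun do rewrite ReD|under eq_fun do rewrite ImD];
exact: meascD.
Qed.
Lemma cmeascN h : cmeasc h -> cmeasc (fun x => - h x).
Proof.
move=> [? ?]; split; [under eq_fun do rewrite ReN|under eq_fun do rewrite ImN];
exact: meascN.
Qed.
Lemma cmeascB h k : cmeasc h -> cmeasc k -> cmeasc (fun x => h x - k x).
Proof. by move=> ? ?; apply: cmeascD => //; exact: cmeascN. Qed.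
Lemma cmeascM h k : cmeasc h -> cmeasc k -> cmeasc (fun x => h x * k x).
Proof.
move=> [? ?] [? ?]; split; [under eq_fun do rewrite ReM|under eq_fun do rewrite ImM].
  by apply: meascB; exact: meascM.
by apply: meascD; exact: meascM.
Qed.
Lemma cmeasc_cabs2 h : cmeasc h -> measc (fun x => cabs (h x) ^+ 2).
Proof.
by move=> [? ?]; under eq_fun do rewrite cabs2; apply: meascD; exact: meascX.
Qed.
Lemma cmeasc_sum (I : Type) (s : seq I) (H : I -> R -> R[i]) :
  (forall i, cmeasc (H i)) -> cmeasc (fun x => \sum_(i <- s) H i x).
Proof.
move=> mH; elim: s => [|i s ih].
  by under eq_fun do rewrite big_nil; exact: cmeasc_cst.
by under eq_fun do rewrite big_cons; exact: cmeascD.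
Qed.

(** AM-GM with a free scale [t]: the right side minus the left is
    [t^-1 * ((|a| - t)^2 + |a| t + b^2)]. A pointwise choice of [t] proportional to the inverse of a
    weight will stand in for the Cauchy-Schwarz inequality. *)
Lemma Re_le_cabs2 z (t : R) : 0 < t -> `|Re z| <= t^-1 * cabs z ^+ 2 + t.
Proof.
move=> t0; rewrite cabs2; set a := Re z; set b := Im z.
have h : 0 <= t^-1 * ((`|a| - t) ^+ 2 + `|a| * t + b ^+ 2).
  apply: mulr_ge0; first by rewrite invr_ge0 ltW.
  by rewrite !addr_ge0 ?sqr_ge0 // mulr_ge0 // ltW.
rewrite -subr_ge0; apply: le_trans h _; rewrite -(real_normK (num_real a)).
rewrite le_eqVlt; apply/orP; left; apply/eqP; field; lra.
Qed.

Lemma Im_le_cabs2 z (t : R) : 0 < t -> `|Im z| <= t^-1 * cabs z ^+ 2 + t.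
Proof.
move=> t0; have := @Re_le_cabs2 (Im z +i* Re z) t t0.
by rewrite !cabs2 /= (addrC (Im z ^+ 2)).
Qed.

(* AM-GM: [|Re h| <= |h|^2 F + 1 / F]. *)
Lemma cintg_weight h F : cmeasc h -> intg (fun x => cabs (h x) ^+ 2 * F x) ->
  intg (fun x => (F x)^-1) -> ae_circle (fun x => 0 < F x) -> cintg h.
Proof.
move=> [m1 m2] i1 i2 p; split.
- apply: intg_le (intgD i1 i2) => //; apply: ae_circle_imp p => x _ Fx.
  by have := @Re_le_cabs2 (h x) (F x)^-1; rewrite invr_gt0 invrK mulrC => /(_ Fx).
- apply: intg_le (intgD i1 i2) => //; apply: ae_circle_imp p => x _ Fx.
  by have := @Im_le_cabs2 (h x) (F x)^-1; rewrite invr_gt0 invrK mulrC => /(_ Fx).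
Qed.

Lemma cintgD h k : cintg h -> cintg k -> cintg (fun x => h x + k x).
Proof.
move=> [? ?] [? ?]; split; [under eq_fun do rewrite ReD|under eq_fun do rewrite ImD];
exact: intgD.
Qed.
Lemma cintgZ z h : cintg h -> cintg (fun x => z * h x).
Proof.
move=> [? ?]; split; [under eq_fun do rewrite ReM|under eq_fun do rewrite ImM].
  by apply: intgB; exact: intgZ.
by apply: intgD; exact: intgZ.
Qed.
Lemma cintgB h k : cintg h -> cintg k -> cintg (fun x => h x - k x).
Proof.
move=> ih ik; apply: cintgD => //.
by under eq_fun do rewrite -mulN1r; exact: cintgZ.
Qed.
Lemma cintgJ h : cintg h -> cintg (fun x => conjc (h x)).
Proof.
move=> [? ?]; split; [under eq_fun do rewrite ReJ|under eq_fun do rewrite ImJ] => //.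
exact: intgN.
Qed.
Lemma cintg_real F : intg F -> cintg (fun x => (F x)%:C).
Proof. by split => //; exact: intg_cst. Qed.
Lemma cintg_cst z : cintg (fun=> z).
Proof. by split; exact: intg_cst. Qed.

Lemma cmeanD h k : cintg h -> cintg k ->
  cmean (fun x => h x + k x) = cmean h + cmean k.
Proof.
move=> [? ?] [? ?]; apply: complex_eq; rewrite ReImE /= -meanD //.
  by congr mean; apply/funext => x; rewrite ReD.
by congr mean; apply/funext => x; rewrite ImD.
Qed.
Lemma cmeanZ z h : cintg h -> cmean (fun x => z * h x) = z * cmean h.
Proof.
move=> [? ?]; apply: complex_eq; rewrite ReImE /= -?meanZ // -?meanB -?meanD //;
  try exact: intgZ.
  by congr mean; apply/funext => x; rewrite ReM.
by congr mean; apply/funext => x; rewrite ImM.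
Qed.
Lemma cmeanB h k : cintg h -> cintg k ->
  cmean (fun x => h x - k x) = cmean h - cmean k.
Proof.
move=> ih ik; under eq_fun do rewrite -[X in _ + X]mulN1r.
by rewrite cmeanD ?cmeanZ ?mulN1r //; exact: cintgZ.
Qed.
Lemma cmean_cst z : cmean (fun=> z) = z.
Proof. by case: z => a b; rewrite /cmean /= !mean_cst. Qed.

Lemma cintg_sum (I : Type) (s : seq I) (H : I -> R -> R[i]) :
  (forall i, cintg (H i)) -> cintg (fun x => \sum_(i <- s) H i x).
Proof.
move=> mH; elim: s => [|i s ih].
  by under eq_fun do rewrite big_nil; exact: cintg_cst.
by under eq_fun do rewrite big_cons; exact: cintgD.
Qed.
Lemma cmean_sum (I : Type) (s : seq I) (H : I -> R -> R[i]) :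
  (forall i, cintg (H i)) ->
  cmean (fun x => \sum_(i <- s) H i x) = \sum_(i <- s) cmean (H i).
Proof.
move=> mH; elim: s => [|i s ih].
  by under eq_fun do rewrite big_nil; rewrite cmean_cst big_nil.
by under eq_fun do rewrite big_cons; rewrite cmeanD ?ih ?big_cons //; exact: cintg_sum.
Qed.

Lemma cmean_eq h k : cmeasc h -> cmeasc k -> ae_circle (fun x => h x = k x) ->
  cmean h = cmean k.
Proof.
move=> [? ?] [? ?] hk; rewrite /cmean; congr (_ +i* _); apply: mean_eq => //;
by apply: ae_circle_imp hk => x _ ->.
Qed.

Lemma cintg_le h F : cmeasc h -> intg F ->
  ae_circle (fun x => `|Re (h x)| <= F x /\ `|Im (h x)| <= F x) -> cintg h.
Proof.
by move=> [? ?] iF hF; split; apply: intg_le iF => //;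
  apply: ae_circle_imp hF => x _ [].
Qed.

End ComplexMeans.

(** * Trigonometric polynomials and their density in weighted L2 *)

Section Exponentials.
Context {R : realType}.
Implicit Types (j k : int) (h : R -> R[i]).
Local Notation Re := complex.Re.
Local Notation Im := complex.Im.
Local Notation mu := (@lebesgue_measure R).

Lemma expi0 (x : R) : expi 0 x = 1.
Proof. by rewrite /expi mul0r cos0 sin0. Qed.

Lemma expiD j k (x : R) : expi (j + k) x = expi j x * expi k x.
Proof.
apply: complex_eq; rewrite ReImE /= rmorphD /= mulrDl ?cosD ?sinD //; ring.
Qed.

Lemma expiJ j (x : R) : conjc (expi j x) = expi (- j) x.
Proof. by rewrite /expi /= mulrNz mulNr cosN sinN. Qed.

Lemma cabs2_expi j (x : R) : cabs (expi j x) ^+ 2 = 1.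
Proof. by rewrite cabs2 /= cos2Dsin2. Qed.

Lemma measc_cos (c : R) : measc (fun x => cos (c * x)).
Proof.
apply: (@measc_cont _ cos); first exact: continuous_cos.
by apply: meascM; [exact: measc_cst|exact: measc_id].
Qed.
Lemma measc_sin (c : R) : measc (fun x => sin (c * x)).
Proof.
apply: (@measc_cont _ sin); first exact: continuous_sin.
by apply: meascM; [exact: measc_cst|exact: measc_id].
Qed.

Lemma cmeasc_expi k : cmeasc (expi k : R -> _).
Proof. by split; [exact: measc_cos|exact: measc_sin]. Qed.

Lemma intgM_bound (F G : R -> R) (M : R) : measc F -> intg G ->
  ae_circle (fun x => `|F x| <= M) -> intg (fun x => F x * G x).
Proof.
move=> mF iG hF; have mG := intg_measc iG.
apply: intg_le (intgZ M (intg_abs iG)) => /=; first exact: meascM.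
by apply: ae_circle_imp hF => x _ hx; rewrite normrM ler_wpM2r.
Qed.

Lemma cintg_expiM k h : cintg h -> cintg (fun x => expi k x * h x).
Proof.
move=> [? ?]; split; [under eq_fun do rewrite ReM|under eq_fun do rewrite ImM].
  by apply: intgB; apply: (@intgM_bound _ _ 1) => //; try exact: measc_cos;
    try exact: measc_sin; apply: ae_circle_all => x _; rewrite ?cos_max ?sin_max.
by apply: intgD; apply: (@intgM_bound _ _ 1) => //; try exact: measc_cos;
    try exact: measc_sin; apply: ae_circle_all => x _; rewrite ?cos_max ?sin_max.
Qed.

Lemma cintg_expi k : cintg (expi k : R -> _).
Proof.
have := cintg_expiM k (cintg_cst (1 : R[i])).
by under eq_fun do rewrite mulr1.
Qed.

Lemma derivable_oo_LRcontinuous_all (F : R -> R) (a b : R) :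
  a < b -> (forall x, derivable F x 1) -> derivable_oo_LRcontinuous F a b.
Proof.
move=> ab dF; have cF x : {for x, continuous F}.
  by apply: differentiable_continuous; apply/derivable1_diffP.
split=> [x _ //| |].
- by apply: cvg_at_right_filter; exact: cF.
- by apply: cvg_at_left_filter; exact: cF.
Qed.

Lemma mean_FTC (f F : R -> R) : continuous f ->
  (forall x, is_derive x (1 : R) F (f x)) -> F pi = F (- pi) -> mean f = 0.
Proof.
move=> cf dF FF.
have lt : - (pi : R) < pi by rewrite gtrN ?pi_gt0.
rewrite /mean /Rintegral (@continuous_FTC2 _ f F) //.
- by rewrite FF -EFinB subrr mulr0.
- exact: continuous_subspaceT.
- by apply: derivable_oo_LRcontinuous_all => // x; have := dF x; exact: ex_derive.
- by move=> x _; rewrite derive1E; case: (dF x).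
Qed.

Lemma sin_int_pi k : sin (k%:~R * pi) = 0 :> R.
Proof.
have h n : sin (n%:R * pi) = 0 :> R.
  elim: n => [|n ih]; first by rewrite mul0r sin0.
  by rewrite -natr1 mulrDl mul1r sinDpi ih oppr0.
by case: k => n; [exact: h|rewrite NegzE mulrNz mulNr sinN h oppr0].
Qed.

(** For nonzero [k] the antiderivatives [sin (k x) / k] and [- cos (k x) / k] take equal values at
    [-pi] and [pi]. *)
Lemma cmean_expi k : cmean (expi k : R -> _) = (k == 0)%:R.
Proof.
have [->|k0] := eqVneq k 0.
  by rewrite (_ : expi 0 = fun=> 1) ?cmean_cst //; apply/funext => x; rewrite expi0.
have c0 : (k%:~R : R) != 0 by rewrite intr_eq0.
apply: complex_eq => /=.
- apply: (@mean_FTC _ (fun x => k%:~R^-1 * sin (k%:~R * x))).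
  + by move=> x; apply: continuous_comp;
      [apply: mulrl_continuous|apply: continuous_cos].
  + move=> x; apply: is_derive_eq; rewrite /= !scaler1 !/GRing.scale /=.
    by field.
  + by rewrite mulrN sinN sin_int_pi oppr0.
- apply: (@mean_FTC _ (fun x => - (k%:~R^-1 * cos (k%:~R * x)))).
  + by move=> x; apply: continuous_comp;
      [apply: mulrl_continuous|apply: continuous_sin].
  + move=> x; apply: is_derive_eq; rewrite /= !scaler1 !/GRing.scale /=.
    by field.
  + by rewrite mulrN cosN.
Qed.

End Exponentials.

(** * The algebra of trigonometric polynomials *)

Section TrigonometricPolynomials.
Context {R : realType}.
Implicit Types (l : seq (int * R[i])) (h p q : R -> R[i]).
Local Notation Re := complex.Re.
Local Notation Im := complex.Im.

(** Pairs of a frequency and a coefficient. Frequencies may repeat, so that sums are concatenations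
    and products are lists of all pairs; the actual Fourier coefficient is then the sum over the
    repetitions. *)
Definition trigl l (x : R) : R[i] := \sum_(z <- l) z.2 * expi z.1 x.

Definition is_trig p := exists l, p = trigl l.

Lemma is_trig_cst (c : R[i]) : is_trig (fun=> c).
Proof.
by exists [:: (0, c)]; apply/funext => x; rewrite /trigl big_seq1 expi0 mulr1.
Qed.

Lemma is_trig_expi k : is_trig (expi k).
Proof.
by exists [:: (k, 1)]; apply/funext => x; rewrite /trigl big_seq1 mul1r.
Qed.

Lemma is_trigD p q : is_trig p -> is_trig q -> is_trig (fun x => p x + q x).
Proof.
move=> [l1 ->] [l2 ->]; exists (l1 ++ l2); apply/funext => x.
by rewrite /trigl big_cat.
Qed.

Lemma is_trigM p q : is_trig p -> is_trig q -> is_trig (fun x => p x * q x).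
Proof.
move=> [l1 ->] [l2 ->].
exists [seq (z.1 + w.1, z.2 * w.2) | z <- l1, w <- l2]; apply/funext => x.
rewrite /trigl big_allpairs_dep /= big_distrl /=; apply: eq_bigr => z _.
rewrite big_distrr /=; apply: eq_bigr => w _.
by rewrite expiD; ring.
Qed.

Lemma is_trigX p n : is_trig p -> is_trig (fun x => p x ^+ n).
Proof.
move=> tp; elim: n => [|n ih]; first exact: is_trig_cst.
by under eq_fun do rewrite exprS; exact: is_trigM.
Qed.

Lemma is_trigB p q : is_trig p -> is_trig q -> is_trig (fun x => p x - q x).
Proof.
move=> tp tq; under eq_fun do rewrite -(mulN1r (q _)).
by apply: is_trigD => //; apply: is_trigM => //; exact: is_trig_cst.
Qed.

Lemma is_trig_cos : is_trig (fun x => (cos x)%:C).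
Proof.
rewrite (_ : (fun x => _) = fun x => (2^-1)%:C * (expi 1 x + expi (-1) x)).
  apply: is_trigM; first exact: is_trig_cst.
  by apply: is_trigD; exact: is_trig_expi.
apply/funext => x; apply: complex_eq;
  rewrite ReImE /= !mulN1r ?mul1r cosN sinN; lra.
Qed.

Lemma is_trig_sin : is_trig (fun x => (sin x)%:C).
Proof.
rewrite (_ : (fun x => _) = fun x => (0 +i* (- 2^-1)) * (expi 1 x - expi (-1) x)).
  apply: is_trigM; first exact: is_trig_cst.
  by apply: is_trigB; exact: is_trig_expi.
apply/funext => x; apply: complex_eq;
  rewrite !ReImE /= !mulN1r ?mul1r cosN sinN; lra.
Qed.

Lemma cmeasc_trigl l : cmeasc (trigl l).
Proof.
apply: cmeasc_sum => z; apply: cmeascM; first exact: cmeasc_cst.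
exact: cmeasc_expi.
Qed.

Lemma cintg_trigl l : cintg (trigl l).
Proof. by apply: cintg_sum => z; apply: cintgZ; exact: cintg_expi. Qed.

Lemma trigl_bounded l : exists M : R, forall x, cabs (trigl l x) ^+ 2 <= M.
Proof.
elim: l => [|z l [M hM]].
  by exists 0 => x; rewrite /trigl big_nil cabs2 /= expr0n addr0.
exists (cabs z.2 ^+ 2 *+ 2 + M *+ 2) => x; rewrite /trigl big_cons.
apply: le_trans (cabs2D_le _ _) _; rewrite cabs2M cabs2_expi mulr1.
by rewrite lerD2l ler_pMn2r // hM.
Qed.

End TrigonometricPolynomials.

(** * Weighted square norms and the closure of the trigonometric polynomials *)

Section WeightedL2.
Context {R : realType}.
Variable W : R -> R.
Hypotheses (iW : intg W) (W0 : forall x, circle x -> 0 <= W x).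
Implicit Types (F : R -> R) (h k p : R -> R[i]).
Local Notation Re := complex.Re.
Local Notation Im := complex.Im.

Definition wL2 h := cmeasc h /\ intg (fun x => cabs (h x) ^+ 2 * W x).
Definition wnorm2 h := mean (fun x => cabs (h x) ^+ 2 * W x).

Lemma wL2_bounded h (M : R) : cmeasc h ->
  ae_circle (fun x => cabs (h x) ^+ 2 <= M) -> wL2 h.
Proof.
move=> mh hM; split=> //; apply: (@intgM_bound _ _ _ M) => //.
  exact: cmeasc_cabs2.
by apply: ae_circle_imp hM => x _ ?; rewrite ger0_norm // sqr_ge0.
Qed.

Lemma wL2D h k : wL2 h -> wL2 k -> wL2 (fun x => h x + k x).
Proof.
move=> [mh ih] [mk ik]; have mhk := cmeascD mh mk; split=> //.
apply: intg_le (intgZ 2 (intgD ih ik)).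
  by apply: meascM; [exact: cmeasc_cabs2|exact: intg_measc].
apply: ae_circle_all => x cx; rewrite ger0_norm ?(mulr_ge0 (sqr_ge0 _)) ?W0 //.
rewrite -mulrDl mulrA ler_wpM2r ?W0 //.
by have := cabs2D_le (h x) (k x); rewrite !mulr2n; lra.
Qed.

Lemma wL2Z (c : R[i]) h : wL2 h -> wL2 (fun x => c * h x).
Proof.
move=> [mh ih]; split; first by apply: cmeascM => //; exact: cmeasc_cst.
by under eq_fun do rewrite cabs2M -mulrA; exact: intgZ.
Qed.

Lemma wL2B h k : wL2 h -> wL2 k -> wL2 (fun x => h x - k x).
Proof.
move=> hh hk; under eq_fun do rewrite -(mulN1r (k _)).
by apply: wL2D => //; exact: wL2Z.
Qed.

Lemma wL2_trigl l : wL2 (trigl l).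
Proof.
have [M hM] := trigl_bounded l; apply: (@wL2_bounded _ M); first exact: cmeasc_trigl.
exact: ae_circle_all.
Qed.

Lemma wnorm2_ge0 h : wL2 h -> 0 <= wnorm2 h.
Proof.
move=> [_ ih]; apply: mean_ge0 => //; apply: ae_circle_all => x cx.
by rewrite (mulr_ge0 (sqr_ge0 _)) ?W0.
Qed.

(** Squared norms are kept throughout, with this factor 2 in place of Minkowski's inequality; it is
    the origin of the tolerances [e / 4] below. *)
Lemma wnorm2D_le h k : wL2 h -> wL2 k ->
  wnorm2 (fun x => h x + k x) <= 2 * (wnorm2 h + wnorm2 k).
Proof.
move=> hh hk; have [_ ihk] := wL2D hh hk; case: hh hk => [mh ih] [mk ik].
rewrite /wnorm2 -meanD // -meanZ; last exact: intgD.
apply: mean_le => //; first by apply: intgZ; exact: intgD.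
apply: ae_circle_all => x cx; rewrite -mulrDl mulrA ler_wpM2r ?W0 //.
by have := cabs2D_le (h x) (k x); rewrite !mulr2n; lra.
Qed.

Lemma wnorm2Z (c : R[i]) h : wL2 h ->
  wnorm2 (fun x => c * h x) = cabs c ^+ 2 * wnorm2 h.
Proof.
move=> [mh ih]; rewrite /wnorm2 -meanZ //; congr mean; apply/funext => x.
by rewrite cabs2M mulrA.
Qed.

Definition trig_closure h :=
  wL2 h /\ forall e : R, 0 < e -> exists l, wnorm2 (fun x => h x - trigl l x) < e.

Lemma trig_closure_trig p : is_trig p -> trig_closure p.
Proof.
move=> [l ->]; split; first exact: wL2_trigl.
move=> e e0; exists l; under eq_fun do rewrite subrr.
rewrite /wnorm2 (_ : (fun x => _) = (fun=> 0)) ?mean_cst //.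
by apply/funext => x; rewrite cabs2 /= expr0n addr0 mul0r.
Qed.

Lemma trig_closure_approx h : wL2 h ->
  (forall e : R, 0 < e -> exists2 k, trig_closure k & wnorm2 (fun x => h x - k x) < e) ->
  trig_closure h.
Proof.
move=> hh H; split=> // e e0.
have e4 : 0 < e / 4 by lra.
have [k [hk Hk] hkl] := H _ e4.
have [l hl] := Hk _ e4; exists l.
rewrite (_ : (fun x => _) = (fun x => (h x - k x) + (k x - trigl l x))); last first.
  by apply/funext => x; rewrite addrA subrK.
have := wnorm2D_le (wL2B hh hk) (wL2B hk (wL2_trigl l)); lra.
Qed.

Lemma trig_closureD h k : trig_closure h -> trig_closure k ->
  trig_closure (fun x => h x + k x).
Proof.
move=> [hh Hh] [hk Hk]; split; first exact: wL2D.
move=> e e0; have e4 : 0 < e / 4 by lra.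
have [l hl] := Hh _ e4; have [l' hl'] := Hk _ e4; exists (l ++ l').
rewrite (_ : (fun x => _) = (fun x => (h x - trigl l x) + (k x - trigl l' x))); last first.
  by apply/funext => x; rewrite {1}/trigl big_cat /= -!/(trigl _ _); ring.
have := wnorm2D_le (wL2B hh (wL2_trigl l)) (wL2B hk (wL2_trigl l')); lra.
Qed.

Lemma trig_closureZ (c : R[i]) h : trig_closure h -> trig_closure (fun x => c * h x).
Proof.
move=> [hh Hh]; split; first exact: wL2Z.
(* The added 1 keeps the divisor positive when [c = 0]. *)
move=> e e0; have c1 : 0 < cabs c ^+ 2 + 1 by rewrite ltr_wpDl // sqr_ge0.
have [l hl] := Hh (e / (cabs c ^+ 2 + 1)) (divr_gt0 e0 c1).
have [l' hl'] := is_trigM (is_trig_cst c) (ex_intro _ l erefl); exists l'.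
rewrite (_ : (fun x => _) = (fun x => c * (h x - trigl l x))); last first.
  by apply/funext => x; rewrite -hl' /= mulrBr.
rewrite wnorm2Z; last by apply: wL2B => //; exact: wL2_trigl.
have g0 := wnorm2_ge0 (wL2B hh (wL2_trigl l)).
move: hl; rewrite ltr_pdivlMr // => hl; apply: le_lt_trans hl.
by rewrite mulrC ler_wpM2l // lerDl.
Qed.

Lemma trig_closureB h k : trig_closure h -> trig_closure k ->
  trig_closure (fun x => h x - k x).
Proof.
move=> hh hk; under eq_fun do rewrite -(mulN1r (k _)).
by apply: trig_closureD => //; exact: trig_closureZ.
Qed.

Lemma trig_closure_sum (I : Type) (s : seq I) (H : I -> R -> R[i]) :
  (forall i, trig_closure (H i)) -> trig_closure (fun x => \sum_(i <- s) H i x).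
Proof.
move=> mH; elim: s => [|i s ih].
  under eq_fun do rewrite big_nil; apply: trig_closure_trig; exact: is_trig_cst.
by under eq_fun do rewrite big_cons; exact: trig_closureD.
Qed.

(** Bounded almost everywhere convergence implies convergence in the weighted norm, by dominated
    convergence with majorant [(2 M)^2 W]. Stability under such limits is what drives the extension
    from rays to all bounded functions. *)
Lemma trig_closure_lim (Fn : nat -> R -> R) F (M : R) :
  (forall n, trig_closure (fun x => (Fn n x)%:C)) -> measc F ->
  (forall n x, circle x -> `|Fn n x| <= M) ->
  ae_circle (fun x => (fun n => Fn n x) @ \oo --> F x) ->
  trig_closure (fun x => (F x)%:C).
Proof.
move=> cFn mF bFn lF.
have mFn n : measc (Fn n) by case: (cFn n) => -[[]].
have bF : ae_circle (fun x => `|F x| <= M).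
  apply: ae_circle_imp lF => x cx lx.
  have lx' : (fun n => `|Fn n x|) @ \oo --> `|F x| by apply: cvg_norm.
  rewrite -(cvg_lim _ lx') //; apply: limr_le; first by apply/cvg_ex; exists `|F x|.
  by apply: nearW => n; exact: bFn.
have wF : wL2 (fun x => (F x)%:C).
  apply: (@wL2_bounded _ (M ^+ 2)); first exact: cmeasc_real.
  apply: ae_circle_imp bF => x _ hx; rewrite cabs2 /= expr0n addr0 -real_normK ?num_real //.
  by rewrite lerXn2r // nnegrE (le_trans _ hx).
apply: trig_closure_approx => // e e0.
have cv : (fun n => mean (fun x => (F x - Fn n x) ^+ 2 * W x)) @ \oo --> mean (fun=> 0 : R).
  apply: (@mean_dominated _ _ _ (fun x => (M + M) ^+ 2 * W x)).
  - move=> n; apply: meascM; last exact: intg_measc.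
    by apply: meascX; exact: meascB.
  - exact: measc_cst.
  - exact: intgZ.
  - apply: ae_circle_imp lF => x _ lx.
    rewrite (_ : 0 = (F x - F x) ^+ 2 * W x); last by rewrite subrr expr0n mul0r.
    apply: cvgM; last exact: cvg_cst.
    have c1 : (fun n => F x - Fn n x) @ \oo --> F x - F x.
      by apply: cvgB => //; exact: cvg_cst.
    by under eq_fun do rewrite expr2; rewrite expr2; exact: cvgM.
  - apply: ae_circle_imp bF => x cx bx n.
    rewrite ger0_norm ?(mulr_ge0 (sqr_ge0 _)) ?W0 // ler_wpM2r ?W0 //.
    rewrite -real_normK ?num_real // lerXn2r ?nnegrE //.
      by rewrite addr_ge0 // (le_trans _ bx).
    by rewrite (le_trans (ler_normB _ _)) // lerD // bFn.
rewrite mean_cst in cv.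
have /cvgrPdist_lt /(_ _ e0) [n _ /(_ n (leqnn n))] := cv.
rewrite /= sub0r normrN => hn; exists (fun x => (Fn n x)%:C) => //.
apply: le_lt_trans hn; apply: le_trans (ler_norm _).
rewrite le_eqVlt; apply/orP; left; apply/eqP; congr mean; apply/funext => x.
by rewrite cabs2 /= subr0 expr0n addr0.
Qed.

End WeightedL2.

(** * Trigonometric polynomials approximating a step *)

Section StepFunctions.
Context {R : realType}.

Lemma bernoulli_ge (y : R) k : 0 <= y <= 1 -> 1 - k%:R * y <= (1 - y) ^+ k.
Proof.
move=> /andP[y0 y1]; elim: k => [|k ih]; first by rewrite mul0r subr0 expr0.
rewrite exprS; apply: le_trans (ler_wpM2l _ ih); last by rewrite subr_ge0.
rewrite -natr1; have : 0 <= k%:R * y * y by rewrite !mulr_ge0.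
lra.
Qed.

(** The induction rests on [(1 - y) (1 + (k + 1) y) = 1 + k y - (k + 1) y^2]. *)
Lemma bernoulli_le (y : R) k : 0 <= y <= 1 -> (1 - y) ^+ k * (1 + k%:R * y) <= 1.
Proof.
move=> /andP[y0 y1]; elim: k => [|k ih]; first by rewrite mul0r addr0 expr0 mulr1.
apply: le_trans ih; rewrite exprSr -mulrA ler_wpM2l ?exprn_ge0 ?subr_ge0 //.
rewrite -natr1; have : 0 <= k%:R * y * y by rewrite !mulr_ge0.
have : 0 <= y * y by rewrite mulr_ge0.
lra.
Qed.

(* The polynomials of the elementary proof of the Stone-Weierstrass theorem:
   they separate [z < 1/2] from [z > 1/2]. *)
Definition threshold (z : R) n : R := 1 - (1 - z ^+ n) ^+ (2 ^ n).

Lemma threshold_bound (z : R) n : 0 <= z <= 1 -> 0 <= threshold z n <= 1.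
Proof.
move=> /andP[z0 z1]; have a1 : z ^+ n <= 1 by rewrite exprn_ile1.
have a0 : 0 <= z ^+ n by rewrite exprn_ge0.
have b : 0 <= 1 - z ^+ n <= 1 by lra.
have c0 : 0 <= (1 - z ^+ n) ^+ (2 ^ n) by apply: exprn_ge0; lra.
have c1 : (1 - z ^+ n) ^+ (2 ^ n) <= 1 by apply: exprn_ile1; lra.
rewrite /threshold; lra.
Qed.

(** Bernoulli's inequality gives [threshold z n <= 2^n z^n = (2 z)^n]. *)
Lemma threshold_lt (z : R) : 0 <= z < 2^-1 -> threshold z @ \oo --> (0 : R).
Proof.
move=> /andP[z0 z1].
have g : (fun n => (2 * z) ^+ n) @ \oo --> (0 : R).
  by apply: cvg_expr; rewrite ger0_norm; lra.
apply: (squeeze_cvgr _ (cvg_cst (0 : R)) g); apply: nearW => n.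
have zz : 0 <= z <= 1 by lra.
have /andP[-> _] /= := threshold_bound n zz.
have zn : 0 <= z ^+ n <= 1.
  by rewrite exprn_ge0 //= exprn_ile1 //; lra.
have := bernoulli_ge (2 ^ n) zn; rewrite /threshold exprMn natrX; lra.
Qed.

(** Here [(1 - z^n)^(2^n) <= 1 / (1 + (2 z)^n) <= (2 z)^(-n)]. *)
Lemma threshold_gt (z : R) : 2^-1 < z <= 1 -> threshold z @ \oo --> (1 : R).
Proof.
move=> /andP[z0 z1]; have zp : 0 < 2 * z by lra.
have g : (fun n => 1 - ((2 * z)^-1) ^+ n) @ \oo --> (1 - 0 : R).
  apply: cvgB; first exact: cvg_cst.
  apply: cvg_expr; rewrite ger0_norm ?invr_ge0 ?ltW // invf_lt1 //; lra.
rewrite subr0 in g.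
apply: (squeeze_cvgr _ g (cvg_cst (1 : R))); apply: nearW => n.
have zz : 0 <= z <= 1 by lra.
have /andP[_ ->] /= := threshold_bound n zz; rewrite andbT.
have zn : 0 <= z ^+ n <= 1.
  by rewrite exprn_ge0 //= ?exprn_ile1 //; lra.
have := bernoulli_le (2 ^ n) zn; rewrite natrX -exprMn.
have pn : 0 < (2 * z) ^+ n by rewrite exprn_gt0.
set A := (1 - z ^+ n) ^+ _; have A0 : 0 <= A by apply: exprn_ge0; lra.
move=> h; rewrite /threshold -/A lerD2l lerN2 exprVn -[leRHS]mul1r ler_pdivlMr //.
lra.
Qed.

Lemma mem_circle (x : R) : circle x = (- pi <= x <= pi).
Proof. by rewrite /circle /= in_itv. Qed.

Lemma ae_circle_neq (c : R) : ae_circle (fun x => x != c).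
Proof.
exists [set c]; split; first exact: measurable_set1.
  exact: lebesgue_measure_set1.
by move=> x /= h; apply: contrapT => /eqP xc; apply: h.
Qed.

(** A trigonometric polynomial in [x] with values in [[0, 1]] that crosses [1/2] on [(-pi, pi)]
    exactly at [c]. The difference of sines is [2 cos (x / 2) sin ((x - c) / 2)], where the cosine
    is positive and the sine has the sign of [x - c]; the half-angle factors are not
    [2 pi]-periodic, but their product is. *)
Definition step_arg (c x : R) : R := 2^-1 * (1 + 2^-1 * (sin (x - c / 2) - sin (c / 2))).

Lemma step_arg_bound c x : 0 <= step_arg c x <= 1.
Proof.
have := sin_max (x - c / 2); have := sin_max (c / 2).
rewrite !ler_norml /step_arg; lra.
Qed.

Lemma step_argE c x :
  step_arg c x = 2^-1 * (1 + cos (x / 2) * sin ((x - c) / 2)).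
Proof.
rewrite /step_arg (_ : x - c / 2 = x / 2 + (x - c) / 2); last by field.
rewrite (_ : sin (c / 2) = sin (x / 2 - (x - c) / 2)); last by congr sin; field.
by rewrite sinB sinD; field.
Qed.

Lemma step_arg_gt c x : - pi < c -> c < x -> x < pi -> 2^-1 < step_arg c x.
Proof.
move=> c0 cx x1; rewrite step_argE.
have h1 : 0 < cos (x / 2) by apply: cos_gt0_pihalf; lra.
have h2 : 0 < sin ((x - c) / 2) by apply: sin_gt0_pi; lra.
have := mulr_gt0 h1 h2; lra.
Qed.

Lemma step_arg_lt c x : - pi < x -> x < c -> c < pi -> step_arg c x < 2^-1.
Proof.
move=> c0 cx x1; rewrite step_argE.
have h1 : 0 < cos (x / 2) by apply: cos_gt0_pihalf; lra.
have h2 : 0 < sin ((c - x) / 2) by apply: sin_gt0_pi; lra.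
rewrite (_ : (x - c) / 2 = - ((c - x) / 2)); last by field.
rewrite sinN; have := mulr_gt0 h1 h2; lra.
Qed.

Definition rtrig (F : R -> R) := is_trig (fun x => (F x)%:C).

Lemma rtrig_cst (c : R) : rtrig (fun=> c).
Proof. exact: is_trig_cst. Qed.
Lemma rtrigB F G : rtrig F -> rtrig G -> rtrig (fun x => F x - G x).
Proof. by move=> hF hG; rewrite /rtrig; under eq_fun do rewrite rmorphB; exact: is_trigB. Qed.
Lemma rtrigD F G : rtrig F -> rtrig G -> rtrig (fun x => F x + G x).
Proof. by move=> hF hG; rewrite /rtrig; under eq_fun do rewrite rmorphD; exact: is_trigD. Qed.
Lemma rtrigM F G : rtrig F -> rtrig G -> rtrig (fun x => F x * G x).
Proof. by move=> hF hG; rewrite /rtrig; under eq_fun do rewrite rmorphM; exact: is_trigM. Qed.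
Lemma rtrigX F n : rtrig F -> rtrig (fun x => F x ^+ n).
Proof. by move=> hF; rewrite /rtrig; under eq_fun do rewrite rmorphXn; exact: is_trigX. Qed.

Lemma rtrig_step c n : rtrig (fun x => threshold (step_arg c x) n).
Proof.
apply: rtrigB; first exact: rtrig_cst.
apply: rtrigX; apply: rtrigB; first exact: rtrig_cst.
apply: rtrigX; apply: rtrigM; first exact: rtrig_cst.
apply: rtrigD; first exact: rtrig_cst.
apply: rtrigM; first exact: rtrig_cst.
apply: rtrigB; last exact: rtrig_cst.
rewrite /rtrig (_ : (fun x => _) =
  (fun x => (sin x * cos (c / 2) - cos x * sin (c / 2))%:C)); last first.
  by apply/funext => x; rewrite sinB.
by apply: rtrigB; apply: rtrigM;
  [exact: is_trig_sin|exact: rtrig_cst|exact: is_trig_cos|exact: rtrig_cst].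
Qed.

End StepFunctions.

(** * From rays to bounded nonnegative functions *)

Section Density.
Import HBNNSimple.
Context {R : realType}.
Variable W : R -> R.
Hypotheses (iW : intg W) (W0 : forall x, circle x -> 0 <= W x).
Implicit Types (F : R -> R) (h : R -> R[i]) (E : set (measurableTypeR R)).
Local Notation Re := complex.Re.
Local Notation Im := complex.Im.

Local Notation cl F := (trig_closure W (fun x => (F x)%:C)).

Lemma measc_indic E : measurable E -> measc (\1_E : R -> R).
Proof. by move=> mE; apply: measurable_funTS; exact: measurable_indic. Qed.

(** If [c] lies outside [(-pi, pi)] the indicator is almost everywhere constant on the circle.
    Otherwise it is the limit of [threshold] applied to [step_arg c], except at [c] and [-pi], [pi],
    where [step_arg] equals [1/2]. *)
Lemma trig_closure_ray (c : R) : cl (\1_`]c, +oo[ : R -> R).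
Proof.
have mE : measc (\1_`]c, +oo[ : R -> R) by apply: measc_indic; exact: measurable_itv.
have E x : (\1_`]c, +oo[ : R -> R) x = (c < x)%R%:R.
  by rewrite indicE; congr (nat_of_bool _)%:R; apply/idP/idP; rewrite inE /= in_itv /= andbT.
have hT (b : R) : rtrig (fun=> b : R) -> `|b| <= 1 ->
    ae_circle (fun x => b = \1_`]c, +oo[ x) -> cl (\1_`]c, +oo[ : R -> R).
  move=> tb b1 hb; apply: (@trig_closure_lim _ W iW W0 (fun _ _ => b) _ 1) => //.
    by move=> n; apply: trig_closure_trig.
  by apply: ae_circle_imp hb => x _ <-; exact: cvg_cst.
have [c1|c1] := leP c (- pi).
  apply: (hT 1); [exact: rtrig_cst|by rewrite normr1|].
  apply: ae_circle_imp (ae_circle_neq (- pi)) => x; rewrite mem_circle E => /andP[xp _] xn.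
  by rewrite (le_lt_trans c1) // lt_neqAle eq_sym xn.
have [c2|c2] := leP pi c.
  apply: (hT 0); [exact: rtrig_cst|by rewrite normr0|].
  apply: ae_circle_all => x; rewrite mem_circle E => /andP[_ xp].
  by rewrite ltNge (le_trans xp).
apply: (@trig_closure_lim _ W iW W0 (fun n x => threshold (step_arg c x) n) _ 1) => //.
- by move=> n; apply: trig_closure_trig => //; exact: rtrig_step.
- move=> n x _; have /andP[a b] := threshold_bound n (step_arg_bound c x).
  by rewrite ger0_norm.
- apply: ae_circle_imp2 (ae_circle_neq c)
    (ae_circle_imp2 _ (ae_circle_neq (- pi)) (ae_circle_neq pi)) => x; last first.
    by move=> _; exact: conj.
  rewrite mem_circle => /andP[x1 x2] n0 [n1 n2]; rewrite E.
  have x1' : - pi < x by rewrite lt_neqAle eq_sym n1.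
  have x2' : x < pi by rewrite lt_neqAle n2.
  have /andP[a b] := step_arg_bound c x.
  have [xc|xc|xc] := ltgtP c x; last by rewrite xc eqxx in n0.
    by apply: threshold_gt; rewrite b andbT step_arg_gt.
  by apply: threshold_lt; rewrite a /= step_arg_lt.
Qed.

(** Rays generate the Borel sets and are closed under intersection (take the larger endpoint). Sets
    with indicator in the closure are stable under complement by linearity, and under disjoint
    countable union by bounded limits. *)
Lemma trig_closure_indic E : measurable E -> cl (\1_E : R -> R).
Proof.
move=> mE; have ME := RGenOInfty.measurableE R.
apply: (@dynkin_induction _ (measurableTypeR R) _ (fun E => cl (\1_E : R -> R)) ME);
  rewrite -?ME //.
- move=> _ _ [a ->] [b ->]; exists (Num.max a b).
  by apply/seteqP; split => x /=; rewrite !in_itv /= !andbT gt_max => /andP.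
- rewrite indicT; apply: trig_closure_trig => //; exact: rtrig_cst.
- by move=> _ [c ->]; exact: trig_closure_ray.
- move=> S _ hS; rewrite (_ : (fun x => _) = (fun x => 1 - (\1_S x)%:C)).
    by apply: trig_closureB => //; apply: trig_closure_trig => //; exact: is_trig_cst.
  apply/funext => x; rewrite !indicE in_setC.
  by case: (x \in S); apply: complex_eq; rewrite ReImE /=; ring.
- move=> F mF tF hF.
  (* By disjointness only the summand [k0] is nonzero at [x]; hence the partial sums are bounded by
     1 and eventually constant. *)
  have S1 x n k0 : F k0 x -> \sum_(k < n) \1_(F k) x = (k0 < n)%N%:R :> R.
    move=> Fx; elim: n => [|n ih]; first by rewrite big_ord0.
    rewrite big_ord_recr /= ih indicE; have [->|nk] := eqVneq n k0.
      by rewrite ltnn mem_set // ltnSn add0r.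
    rewrite memNset ?addr0 ?ltnS.
      by rewrite [in RHS]leq_eqVlt eq_sym (negbTE nk).
    by move=> Fn; case/eqP: nk; apply: (tF n k0) => //; exists x.
  have S0 x n : ~ (\bigcup_k F k) x -> \sum_(k < n) \1_(F k) x = 0 :> R.
    move=> nF; rewrite big1 // => k _; rewrite indicE memNset // => Fx.
    by apply: nF; exists k.
  apply: (@trig_closure_lim _ W iW W0 (fun n x => \sum_(k < n) \1_(F k) x) _ 1).
  + move=> n; under eq_fun do rewrite rmorph_sum /=.
    by apply: trig_closure_sum.
  + by apply: measc_indic; exact: bigcup_measurable.
  + move=> n x _; have [[k _ Fx]|nF] := pselect ((\bigcup_k F k) x).
      by rewrite (S1 _ _ k Fx); case: (_ < _)%N; rewrite ?normr1 ?normr0.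
    by rewrite S0 // normr0.
  + apply: ae_circle_all => x _; have [[k0 _ Fx]|nF] := pselect ((\bigcup_k F k) x).
      rewrite indicE mem_set; last by exists k0.
      apply: cvg_near_cst; exists k0.+1 => // n /= kn.
      by rewrite (S1 _ _ k0 Fx) kn.
    rewrite indicE memNset //; under eq_fun do rewrite S0 //.
    exact: cvg_cst.
- by rewrite -[<<s _ >>]ME.
Qed.

(** The increasing simple functions converging to [F] stay below [F], hence below [M], and each is a
    finite combination of indicators of its level sets. *)
Lemma trig_closure_bounded_ge0 F (M : R) : measc F ->
  (forall x, circle x -> 0 <= F x <= M) -> cl F.
Proof.
move=> mF FM.
have mF' : measurable_fun (circle : set (measurableTypeR R)) (EFin \o F).
  by apply/measurable_EFinP.
pose f n := nnsfun_approx (measurable_circle (R := R)) mF' n.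
have F0 x : circle x -> (0 <= (EFin \o F) x)%E.
  by move=> cx; rewrite lee_fin; have /andP[] := FM x cx.
have cf x : circle x -> (fun n => f n x) @ \oo --> F x.
  move=> cx; have := cvg_nnsfun_approx measurable_circle mF' F0 cx.
  by move=> /fine_cvg.
apply: (@trig_closure_lim _ W iW W0 (fun n x => f n x) _ M) => //.
- move=> n; rewrite (_ : (fun x => _) =
     (fun x => \sum_(y <- finmap.enum_fset (fset_set (range (f n))))
     y%:C * (\1_(f n @^-1` [set y]) x)%:C)).
    apply: trig_closure_sum => // y; apply: trig_closureZ => //.
    exact: trig_closure_indic.
  apply/funext => x; rewrite {1}fimfunE fsbig_finite //= rmorph_sum /=.
  by apply: eq_bigr => y _; rewrite rmorphM.
- move=> n x cx; rewrite ger0_norm //.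
  have /andP[_ FxM] := FM x cx; apply: le_trans FxM.
  by have := le_approx n F0 cx; rewrite lee_fin /f nnsfun_approxE.
- by apply: ae_circle_all => x cx; exact: cf.
Qed.

End Density.

Lemma norm_le_sqr (R : realType) (a : R) : `|a| <= a ^+ 2 + 1.
Proof.
rewrite -(real_normK (num_real a)); set t := `|a|.
by have := sqr_ge0 (t - 2^-1); have := sqr_ge0 t; rewrite sqrrB; lra.
Qed.

(** * Density for almost everywhere bounded functions *)

Section BoundedClosure.
Context {R : realType}.
Variable W : R -> R.
Hypotheses (iW : intg W) (W0 : forall x, circle x -> 0 <= W x).
Local Notation Re := complex.Re.
Local Notation Im := complex.Im.

(** Clamping [F] to [[-M', M']] turns the almost everywhere bound into an everywhere bound, and
    adding [M'] makes the result nonnegative. The constant sequence at the clamped function then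
    converges to [F] almost everywhere. *)
Lemma trig_closure_real_bounded (F : R -> R) (M : R) : measc F ->
  ae_circle (fun x => `|F x| <= M) -> trig_closure W (fun x => (F x)%:C).
Proof.
move=> mF FM; pose M' := `|M|; have M0 : 0 <= M' := normr_ge0 M.
pose G x := Num.min (Num.max (F x) (- M')) M'.
have mG : measc G.
  by apply: measurable_minr; [apply: measurable_maxr => //|]; exact: measc_cst.
have hG : trig_closure W (fun x => (G x + M')%:C - M'%:C).
  apply: trig_closureB => //; last first.
    by apply: trig_closure_trig => //; exact: is_trig_cst.
  apply: (@trig_closure_bounded_ge0 _ W iW W0 _ (M' + M')).
    by apply: meascD => //; exact: measc_cst.
  move=> x _; rewrite lerD2r ge_min lexx orbT andbT -lerBlDr sub0r.
  by rewrite le_min le_max lexx orbT /= ge0_cp // .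
apply: (@trig_closure_lim _ W iW W0 (fun _ x => G x) F M') => //.
- move=> _; rewrite (_ : (fun x => _) = (fun x => (G x + M')%:C - M'%:C)) //.
  by apply/funext => x; rewrite -rmorphB /= addrK.
- move=> _ x _; rewrite ler_norml ge_min lexx orbT andbT.
  by rewrite le_min le_max lexx orbT /= ge0_cp.
- apply: ae_circle_imp FM => x _ hx.
  have hx' : `|F x| <= M' by apply: le_trans hx _; exact: ler_norm.
  move: hx'; rewrite ler_norml => /andP[h1 h2].
  rewrite /G max_l // min_l //; exact: cvg_cst.
Qed.

Lemma trig_closure_ae_bounded (h : R -> R[i]) (M : R) : cmeasc h ->
  ae_circle (fun x => cabs (h x) ^+ 2 <= M) -> trig_closure W h.
Proof.
move=> [m1 m2] hM.
rewrite (_ : h = (fun x => (Re (h x))%:C + 'i%C * (Im (h x))%:C)); last first.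
  by apply/funext => x; apply: complex_eq; rewrite !ReImE /=; ring.
have le (a b : R) : a ^+ 2 + b ^+ 2 <= M -> `|a| <= M + 1.
  by move=> ab; have := norm_le_sqr a; have := sqr_ge0 b; lra.
apply: trig_closureD => //; last apply: trig_closureZ => //.
- apply: (@trig_closure_real_bounded _ (M + 1)) => //.
  by apply: ae_circle_imp hM => x _; rewrite cabs2; exact: le.
- apply: (@trig_closure_real_bounded _ (M + 1)) => //.
  by apply: ae_circle_imp hM => x _; rewrite cabs2 addrC; exact: le.
Qed.

End BoundedClosure.

(** * Fourier coefficients and the frequencies 0, ..., N *)

Section FourierCoefficients.
Context {R : realType}.
Implicit Types (h k : R -> R[i]) (l : seq (int * R[i])).
Local Notation Re := complex.Re.
Local Notation Im := complex.Im.

Definition fcoef (j : int) h : R[i] := cmean (fun x => expi (- j) x * h x).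

Lemma fcoefD j h k : cintg h -> cintg k ->
  fcoef j (fun x => h x + k x) = fcoef j h + fcoef j k.
Proof.
move=> ih ik; rewrite /fcoef; under eq_fun do rewrite mulrDr.
by rewrite cmeanD //; exact: cintg_expiM.
Qed.

Lemma fcoefZ j c h : cintg h -> fcoef j (fun x => c * h x) = c * fcoef j h.
Proof.
move=> ih; rewrite /fcoef; under eq_fun do rewrite mulrCA.
by rewrite cmeanZ //; exact: cintg_expiM.
Qed.

Lemma fcoefB j h k : cintg h -> cintg k ->
  fcoef j (fun x => h x - k x) = fcoef j h - fcoef j k.
Proof.
move=> ih ik; rewrite /fcoef; under eq_fun do rewrite mulrBr.
by rewrite cmeanB //; exact: cintg_expiM.
Qed.

Lemma fcoef_expi j (k : int) : fcoef j (expi k : R -> _) = (k == j)%:R.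
Proof.
rewrite /fcoef; under eq_fun do rewrite -expiD.
by rewrite cmean_expi addrC subr_eq0.
Qed.

Definition coefl l (j : int) : R[i] := \sum_(z <- l | z.1 == j) z.2.

Lemma fcoef_trigl j l : fcoef j (trigl l) = coefl l j.
Proof.
rewrite /coefl; elim: l => [|z l ih].
  rewrite big_nil /fcoef (_ : (fun x => _) = fun=> 0) ?cmean_cst //.
  by apply/funext => x; rewrite /trigl big_nil mulr0.
rewrite big_cons (_ : trigl _ = (fun x => z.2 * expi z.1 x + trigl l x)); last first.
  by apply/funext => x; rewrite /trigl big_cons.
rewrite fcoefD ?fcoefZ ?ih ?fcoef_expi; [|exact: cintg_expi| |exact: cintg_trigl].
  by case: eqP; rewrite ?mulr1 ?mulr0 ?add0r.
by apply: cintgZ; exact: cintg_expi.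
Qed.

Lemma trigl_coefl l (s : seq int) (x : R) : uniq s ->
  {subset [seq z.1 | z <- l] <= s} ->
  trigl l x = \sum_(j <- s) coefl l j * expi j x.
Proof.
move=> us sub; under eq_bigr do rewrite /coefl big_distrl /=.
rewrite (exchange_big_dep xpredT) //= /trigl big_seq [RHS]big_seq.
apply: eq_bigr => z zl; rewrite -big_filter.
have -> : [seq j <- s | z.1 == j] = [:: z.1].
  rewrite -(@filter_pred1_uniq _ s z.1) //; last by apply: sub; exact: map_f.
  by apply: eq_filter => j; rewrite eq_sym.
by rewrite big_seq1.
Qed.

(** Isolates the block of forbidden frequencies, which has to be removed from an approximant before
    it counts as observed. *)
Lemma trigl_split N l : exists2 p : R -> R[i], observed_poly N p &
  trigl l = (fun x => \sum_(j < N.+1) coefl l j%:Z * expi j%:Z x + p x).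
Proof.
pose s := [seq j <- undup [seq z.1 | z <- l] | ~~ (0 <= j <= N%:Z)].
pose t := [seq j%:Z | j <- iota 0 N.+1].
exists (fun x => \sum_(j <- s) coefl l j * expi j x).
  by exists s, (coefl l); split => //; rewrite filter_all.
have mt j : (j \in t) = (0 <= j <= N%:Z).
  apply/mapP/idP => [[n + ->]|]; first by rewrite mem_iota add0n /= ltnS lez_nat.
  by case: j => // n; rewrite lez_nat => nN; exists n; rewrite // mem_iota /= add0n ltnS.
apply/funext => x; rewrite (@trigl_coefl l (t ++ s)).
- rewrite big_cat /=; congr (_ + _).
  by rewrite big_map -[X in iota 0 X]subn0 -/(index_iota _ _) big_mkord.
- rewrite cat_uniq map_inj_uniq ?iota_uniq /=; last by move=> ? ? [].
  rewrite filter_uniq ?undup_uniq // andbT; apply/hasPn => j.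
  by rewrite mem_filter mt => /andP[].
- by move=> j jl; rewrite mem_cat mt mem_filter mem_undup jl andbT orbN.
Qed.

(** Bessel's inequality for one coefficient: the variance inequality applies to the real and
    imaginary parts of [expi (- j) * h], whose modulus is that of [h]. *)
Lemma cabs2_fcoef_le j h : cintg h -> intg (fun x => cabs (h x) ^+ 2) ->
  cabs (fcoef j h) ^+ 2 <= mean (fun x => cabs (h x) ^+ 2).
Proof.
move=> ih ih2; have [i1 i2] := cintg_expiM (- j) ih.
have E x : cabs (h x) ^+ 2 = Re (expi (- j) x * h x) ^+ 2 + Im (expi (- j) x * h x) ^+ 2.
  by rewrite -cabs2 cabs2M cabs2_expi mul1r.
have j1 : intg (fun x => Re (expi (- j) x * h x) ^+ 2).
  apply: intg_le ih2; first by apply: meascX; exact: intg_measc.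
  by apply: ae_circle_all => x _; rewrite ger0_norm ?sqr_ge0 // E lerDl sqr_ge0.
have j2 : intg (fun x => Im (expi (- j) x * h x) ^+ 2).
  apply: intg_le ih2; first by apply: meascX; exact: intg_measc.
  by apply: ae_circle_all => x _; rewrite ger0_norm ?sqr_ge0 // E lerDr sqr_ge0.
rewrite (_ : (fun x => cabs (h x) ^+ 2) = (fun x => Re (expi (- j) x * h x) ^+ 2 +
   Im (expi (- j) x * h x) ^+ 2)); last by apply/funext => x; exact: E.
by rewrite meanD // /fcoef cabs2 /= lerD //; exact: sqr_mean_le.
Qed.

(** Iteration of [cabs2D_le]. The exponential constant is harmless, as the number of terms will be
    [N.+1] with [N] fixed. *)
Lemma cabs2_sum_le n (z : nat -> R[i]) :
  cabs (\sum_(i < n) z i) ^+ 2 <= 2 ^+ n * \sum_(i < n) cabs (z i) ^+ 2.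
Proof.
elim: n => [|n ih]; first by rewrite !big_ord0 cabs2 /= expr0n addr0 mulr0.
rewrite !big_ord_recr /=; apply: le_trans (cabs2D_le _ _) _.
have a0 := sqr_ge0 (cabs (z n)).
have b1 : 1 <= 2 ^+ n :> R by rewrite exprn_ege1 // ler1n.
have := ler_wpM2r a0 b1; rewrite mul1r [2 ^+ n.+1]exprS -mulrA mulrDr !mulr2n.
lra.
Qed.

End FourierCoefficients.

(** * Bounded functions in the observation space *)

Section BoundedObserved.
Context {R : realType}.
Variables (N : nat) (f g : R -> R).
Hypotheses (df : spectral_density f) (dg : spectral_density g).

(** Approximate [h] by [trigl l] in the weight [W = f + g + 1]. The summand 1 gives control of the
    unweighted norm, hence of the coefficients of [h - trigl l]; as those of [h] with indices
    [0, ..., N] vanish, the corresponding block [r] of [trigl l] is uniformly small, and [p] is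
    [trigl l] without it. *)
Lemma L2N_bounded (h : R -> R[i]) (M : R) : cmeasc h ->
  ae_circle (fun x => cabs (h x) ^+ 2 <= M) ->
  (forall j : 'I_N.+1, fcoef j%:Z h = 0) -> L2N N f g h.
Proof.
case: df dg => [f0 f1] [g0 g1] mh hM hc.
have iF : intg (fun x => f x + g x) by apply: intgD.
have F0 x : circle x -> 0 <= f x + g x by move=> cx; rewrite addr_ge0 ?f0 ?g0.
pose W x := f x + g x + 1.
have iW : intg W by apply: intgD => //; exact: intg_cst.
have W1 x : circle x -> 1 <= W x by move=> cx; rewrite lerDr F0.
have W0 x : circle x -> 0 <= W x by move=> cx; rewrite (le_trans ler01) // W1.
have mh2 := cmeasc_cabs2 mh.
have emF k : wL2 W k -> wL2 (fun x => f x + g x) k.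
  move=> [mk ik]; split=> //; apply: intg_le ik.
    by apply: meascM; [exact: cmeasc_cabs2|exact: intg_measc].
  apply: ae_circle_all => x cx; rewrite ger0_norm ?(mulr_ge0 (sqr_ge0 _)) ?F0 //.
  by rewrite ler_wpM2l ?sqr_ge0 // lerDl.
have [mm ihF] := emF _ (wL2_bounded iW mh hM).
case: mm => m1 m2; split=> //.
  by rewrite emean_intg // ltry.
move=> e e0; have [hh H] := trig_closure_ae_bounded iW W0 mh hM.
have mW0 : 0 <= mean W by apply: mean_ge0 => //; exact: ae_circle_all.
(* If the [N.+1] coefficients of [r] have squared modulus at most [d], then [|r|^2 <= K d]. *)
pose K : R := 2 ^+ N.+1 * N.+1%:R.
have K0 : 0 <= K by rewrite mulr_ge0 // exprn_ge0.
have KW : 0 <= K * mean W by rewrite mulr_ge0.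
(* Chosen so that the final bound [2 * (d + K * d * mean W)] equals [e / 2]. *)
pose d := e / (4 * (1 + K * mean W)).
have d0 : 0 < d by rewrite divr_gt0 // mulr_gt0 //; lra.
have [l hl] := H _ d0; have [p op pE] := trigl_split N l; exists p => //.
pose D x := h x - trigl l x.
have wD : wL2 W D by apply: wL2B => //; exact: wL2_trigl.
have ch : cintg h.
  apply: (cintg_le mh (intg_cst (M + 1))); apply: ae_circle_imp hM => x _.
  rewrite cabs2; set a := complex.Re _; set b := complex.Im _ => ab.
  have := norm_le_sqr a; have := norm_le_sqr b; have := sqr_ge0 a; have := sqr_ge0 b.
  by split; lra.
have iD : intg (fun x => cabs (D x) ^+ 2).
  case: wD => mD; apply: intg_le; first exact: cmeasc_cabs2.
  apply: ae_circle_all => x cx; rewrite ger0_norm ?sqr_ge0 //.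
  by rewrite ler_peMr ?sqr_ge0 ?W1.
(* For these [j] the coefficient of [trigl l] is minus that of [h - trigl l]. *)
have cD (j : nat) : (j < N.+1)%N -> cabs (coefl l j%:Z) ^+ 2 <= d.
  move=> jN; rewrite -fcoef_trigl -[fcoef _ _]opprK.
  have := hc (Ordinal jN) => /= hj;
  rewrite -[- fcoef _ _]add0r -hj -fcoefB //; last exact: cintg_trigl.
  rewrite -mulN1r cabs2M cabs2 ReImE /= oppr0 expr0n addr0 sqrrN expr1n mul1r.
  apply: le_trans (cabs2_fcoef_le _ _ _) _ => //.
    by apply: cintgB => //; exact: cintg_trigl.
  apply: le_trans (ltW hl); apply: mean_le => //; first by case: wD.
  by apply: ae_circle_all => x cx; rewrite ler_peMr ?sqr_ge0 ?W1.
pose r x : R[i] := \sum_(j < N.+1) coefl l j%:Z * expi j%:Z x.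
have rK x : cabs (r x) ^+ 2 <= K * d.
  apply: le_trans (cabs2_sum_le _ (fun j => coefl l j%:Z * expi j%:Z x)) _.
  rewrite -mulrA ler_wpM2l ?exprn_ge0 //.
  rewrite (_ : N.+1%:R * d = \sum_(j < N.+1) d); last first.
    by rewrite sumr_const card_ord mulr_natl.
  by apply: ler_sum => j _; rewrite cabs2M cabs2_expi mulr1 cD.
have mr : cmeasc r.
  by apply: cmeasc_sum => j; apply: cmeascM; [exact: cmeasc_cst|exact: cmeasc_expi].
have wr : wL2 W r by apply: (wL2_bounded iW mr (ae_circle_all _)) => x _; exact: rK.
have hp : (fun x => h x - p x) = (fun x => D x + r x).
  by apply/funext => x; rewrite /D /r pE; ring.
have wp : wL2 W (fun x => h x - p x) by rewrite hp; apply: wL2D.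
have [mp ip] := emF _ wp; rewrite emean_intg // lte_fin.
have nr : wnorm2 W r <= K * d * mean W.
  case: wr => _ ir; rewrite -meanZ //; apply: mean_le => //; first exact: intgZ.
  by apply: ae_circle_all => x cx; rewrite ler_wpM2r ?W0.
have nD := wnorm2D_le iW W0 wD wr; rewrite -hp in nD.
have le1 : mean (fun x => cabs (h x - p x) ^+ 2 * (f x + g x)) <= wnorm2 W (fun x => h x - p x).
  apply: mean_le => //; first by case: wp.
  by apply: ae_circle_all => x cx; rewrite ler_wpM2l ?sqr_ge0 // lerDl.
have dE : d * (1 + K * mean W) * 4 = e by rewrite /d; field; lra.
have hd : wnorm2 W D < d by exact: hl.
apply: le_lt_trans le1 _; apply: le_lt_trans nD _.
have dp : 0 < d * (1 + K * mean W) by apply: mulr_gt0 => //; lra.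
have lt : 2 * (d + K * d * mean W) < e.
  rewrite -[X in _ < X]dE.
  have -> : 2 * (d + K * d * mean W) = d * (1 + K * mean W) * 2 by ring.
  lra.
lra.
Qed.

End BoundedObserved.

(** * The optimal characteristic *)

Lemma measurable_inve (R : realType) (F : R -> R) : measc F ->
  measurable_fun (circle : set (measurableTypeR R)) (fun x => ((F x)%:E)^-1)%E.
Proof.
move=> mF; rewrite (_ : (fun x => _) =
  fun x => if F x == 0 then +oo%E else ((F x)^-1)%:E); last first.
  by apply/funext => x; rewrite inver.
have mG2 : measurable_fun (circle : set (measurableTypeR R)) (fun x => ((F x)^-1)%:E).
  by apply/measurable_EFinP; exact: meascV.
apply: measurable_fun_if => /=; first exact: measurable_circle.
- exact: (@measurable_fun_eqr _ (measurableTypeR R) R _ F (cst 0) mF (measc_cst 0)).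
- exact: measurable_cst.
- by apply: measurable_funS mG2; [exact: measurable_circle|move=> x []].
Qed.

Lemma intg_minimality (R : realType) (f g : R -> R) : measc (fun x => f x + g x) ->
  ae_circle (fun x => 0 < f x + g x) -> intg (fun x => (f x + g x)^-1) ->
  minimality f g.
Proof.
move=> mF pos iV; rewrite /minimality.
have lt := integrable_lty (@measurable_circle R) iV.
apply: le_lt_trans lt; rewrite le_eqVlt; apply/orP; left; apply/eqP.
apply: ae_eq_integral => //; first exact: measurable_inve.
  by apply/measurable_EFinP; exact: intg_measc iV.
by apply: ae_circle_imp pos => x _ h; rewrite inver gt_eqF.
Qed.

(** * Consequences of the minimality condition *)

Section Minimality.
Context {R : realType}.
Variables (f g : R -> R).
Hypotheses (df : spectral_density f) (dg : spectral_density g)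
  (min_fg : minimality f g).
Local Notation mu := (@lebesgue_measure R).
Local Notation Re := complex.Re.
Local Notation Im := complex.Im.
Local Notation F := (fun x => f x + g x).

Lemma intg_total : intg F.
Proof. by case: df => _ ?; case: dg => _ ?; exact: intgD. Qed.

Lemma total_ge0 x : circle x -> 0 <= f x + g x.
Proof. by move=> cx; rewrite addr_ge0 // ?df.1 ?dg.1. Qed.

(** An integrable extended-valued function is finite almost everywhere, and the extended inverse is
    infinite exactly where [f + g] vanishes. *)
Lemma minimality_intg : ae_circle (fun x => 0 < F x) /\ intg (fun x => (F x)^-1).
Proof.
pose G x := (((F x)%:E)^-1)%E.
have GE x : G x = if F x == 0 then +oo%E else ((F x)^-1)%:E by rewrite /G inver.
have G0 x : circle x -> (0 <= G x)%E.
  by move=> cx; rewrite GE; case: ifP => // _; rewrite lee_fin invr_ge0 total_ge0.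
have mF : measc F by exact: intg_measc intg_total.
have mG := measurable_inve mF.
have iG : mu.-integrable circle G.
  apply/integrableP; split=> //; apply: le_lt_trans min_fg.
  rewrite le_eqVlt; apply/orP; left; apply/eqP; apply: eq_integral => x.
  by rewrite inE => cx; rewrite gee0_abs // G0.
have pos : ae_circle (fun x => 0 < F x).
  have := integrable_ae measurable_circle iG.
  rewrite /ae_circle; apply: (@filterS _ _ (ae_filter_ringOfSetsType mu)) => x h cx.
  have := h cx; rewrite GE; case: eqP => // /eqP Fx _.
  by rewrite lt_neqAle eq_sym Fx total_ge0.
split=> //.
(* [fine] sends [+oo] to 0, so this function is dominated by [G] everywhere on the circle. *)
have iG' : intg (fun x => fine (G x)).
  apply: le_integrable iG => //.
    by apply/measurable_EFinP; apply: measurableT_comp => //; exact: measurable_fine.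
  by move=> x cx; rewrite /= GE; case: ifP => _; rewrite /= ?leey.
apply: intg_le iG'; first exact: meascV.
apply: ae_circle_imp pos => x _ Fx.
by rewrite GE gt_eqF //= ger0_norm // invr_ge0 ltW.
Qed.

(** Continuity of Fourier coefficients on L2(f + g), which is what minimality provides: the AM-GM
    bound with [t = s / F] is integrated over the circle. *)
Lemma fcoef_weight_le (d : R -> R[i]) j (s : R) : wL2 F d -> 0 < s ->
  `|Re (fcoef j d)| <= s^-1 * wnorm2 F d + s * mean (fun x => (F x)^-1) /\
  `|Im (fcoef j d)| <= s^-1 * wnorm2 F d + s * mean (fun x => (F x)^-1).
Proof.
move=> [md id] s0; have [pos iV] := minimality_intg.
have cd : cintg d by exact: (cintg_weight md id iV pos).
have [i1 i2] := cintg_expiM (- j) cd.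
have iB : intg (fun x => s^-1 * (cabs (d x) ^+ 2 * F x) + s * (F x)^-1).
  by apply: intgD; exact: intgZ.
have bE : s^-1 * wnorm2 F d + s * mean (fun x => (F x)^-1) =
    mean (fun x => s^-1 * (cabs (d x) ^+ 2 * F x) + s * (F x)^-1).
  by rewrite meanD ?meanZ //; exact: intgZ.
rewrite bE /fcoef /=.
have E x : 0 < F x ->
    s^-1 * (cabs (d x) ^+ 2 * F x) + s * (F x)^-1 =
    (s / F x)^-1 * cabs (expi (- j) x * d x) ^+ 2 + s / F x.
  by move=> Fx; rewrite cabs2M cabs2_expi mul1r invf_div; congr (_ + _); ring.
split; apply: le_trans (mean_norm _) _ => //; apply: mean_le => //;
  try exact: intg_abs; apply: ae_circle_imp pos => x _ Fx; rewrite E //;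
  [apply: Re_le_cabs2|apply: Im_le_cabs2]; exact: divr_gt0.
Qed.

Lemma fcoef_observed_poly N (p : R -> R[i]) (j : 'I_N.+1) : observed_poly N p ->
  fcoef j%:Z p = 0 /\ exists l, p = trigl l.
Proof.
move=> [s [c [/allP hs ->]]].
have E : (fun x => \sum_(k <- s) c k * expi k x) = trigl [seq (k, c k) | k <- s].
  by apply/funext => x; rewrite /trigl big_map.
split; last by exists [seq (k, c k) | k <- s].
rewrite E fcoef_trigl /coefl big_map big_seq_cond big1 // => k /andP[ks /= /eqP kj].
by have := hs k ks; rewrite kj lez_nat /= lez_nat -ltnS ltn_ord.
Qed.

Lemma le_eps_eq0 (x c : R) : (forall s, 0 < s -> `|x| <= s * c) -> x = 0.
Proof.
move=> h; apply/eqP; rewrite -normr_le0; apply/ler_addgt0Pr => e e0.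
have c1 : 0 < `|c| + 1 by rewrite ltr_wpDl.
have := h (e / (`|c| + 1)) (divr_gt0 e0 c1); rewrite add0r => /le_trans; apply.
rewrite -mulrA ger_pMr // mulrC ler_pdivrMr // mul1r.
by apply: le_trans (ler_norm _) _; lra.
Qed.

(** The coefficients [0, ..., N] vanish on observed polynomials and are continuous on L2(f + g),
    hence vanish on the closure. *)
Lemma L2N_admissible N (h : R -> R[i]) : L2N N f g h ->
  wL2 F h /\ forall j : 'I_N.+1, fcoef j%:Z h = 0.
Proof.
move=> [m1 m2 lt app]; have mh : cmeasc h by [].
have [pos iV] := minimality_intg.
have wh : wL2 F h.
  split=> //; apply: emean_ltyP lt; last by move=> x cx; rewrite mulr_ge0 ?total_ge0 // sqr_ge0.
  by apply: meascM; [exact: cmeasc_cabs2|exact: intg_measc intg_total].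
have ch : cintg h by case: wh => _ ih; exact: (cintg_weight mh ih iV pos).
split=> // j.
have B s : 0 < s ->
    `|Re (fcoef j%:Z h)| <= s * (1 + mean (fun x => (F x)^-1)) /\
    `|Im (fcoef j%:Z h)| <= s * (1 + mean (fun x => (F x)^-1)).
  (* With squared distance below [s * s], the term [s^-1 * wnorm2] of the bound is at most [s]. *)
  move=> s0; have [p op] := app (s * s) (mulr_gt0 s0 s0).
  have [pj [l pl]] := fcoef_observed_poly j op.
  have wd : wL2 F (fun x => h x - p x).
    apply: wL2B => //; [exact: intg_total|exact: total_ge0|].
    rewrite pl; apply: wL2_trigl; exact: intg_total.
  rewrite emean_intg; last by case: wd.
  rewrite lte_fin => lts.
  have -> : fcoef j%:Z h = fcoef j%:Z (fun x => h x - p x).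
    by rewrite fcoefB ?pj ?subr0 // pl; exact: cintg_trigl.
  have [b1 b2] := fcoef_weight_le j%:Z wd s0.
  have bb : s^-1 * wnorm2 F (fun x => h x - p x) <= s.
    by rewrite mulrC ler_pdivrMr // ltW.
  by rewrite mulrDr mulr1; split; [apply: le_trans b1 _|apply: le_trans b2 _]; rewrite lerD2r.
by apply: complex_eq; [apply: (@le_eps_eq0 _ (1 + mean (fun x => (F x)^-1))) => s s0|
  apply: (@le_eps_eq0 _ (1 + mean (fun x => (F x)^-1))) => s s0]; have [] := B s s0.
Qed.

End Minimality.

(** * Toeplitz matrices as compressed multiplication operators *)

Section TrigPoly.
Context {R : realType}.
Variable N : nat.
Implicit Types (a b c : 'cV[R[i]]_N.+1) (psi : R -> R).
Local Notation Re := complex.Re.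
Local Notation Im := complex.Im.

Lemma trig_polyE c : exists l, trig_poly c = trigl l.
Proof.
exists [seq (j%:Z, c j 0) | j : 'I_N.+1 <- index_enum _]; apply/funext => x.
by rewrite /trigl big_map.
Qed.

Lemma cmeasc_trig_poly c : cmeasc (trig_poly c).
Proof. by have [l ->] := trig_polyE c; exact: cmeasc_trigl. Qed.

Lemma trig_poly_bounded c : exists M : R, forall x, cabs (trig_poly c x) ^+ 2 <= M.
Proof. by have [l ->] := trig_polyE c; exact: trigl_bounded. Qed.

Lemma fcoef_trig_poly c (j : 'I_N.+1) : fcoef j%:Z (trig_poly c) = c j 0.
Proof.
have -> : trig_poly c = trigl [seq (j%:Z, c j 0) | j : 'I_N.+1 <- index_enum _].
  by apply/funext => x; rewrite /trigl big_map.
by rewrite fcoef_trigl /coefl big_map /= (big_pred1 j).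
Qed.

Lemma cintg_trig_polyM c h : cintg h -> cintg (fun x => trig_poly c x * h x).
Proof.
move=> ih; under eq_fun do rewrite big_distrl /=.
apply: cintg_sum => j; under eq_fun do rewrite -mulrA.
by apply: cintgZ; exact: cintg_expiM.
Qed.

(** [fourier_mx N psi] is multiplication by [psi] compressed to the frequencies [0, ..., N]; this
    converts the normal equations into matrix identities. *)
Lemma fcoef_trig_polyM c psi (j : 'I_N.+1) : intg psi ->
  fcoef j%:Z (fun x => trig_poly c x * (psi x)%:C) = (fourier_mx N psi *m c) j 0.
Proof.
move=> /cintg_real ip; rewrite /fcoef mxE.
rewrite (_ : (fun x => _) = (fun x => \sum_(k < N.+1)
   c k 0 * (expi (- (j%:Z - k%:Z)) x * (psi x)%:C))).
  rewrite cmean_sum.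
    by apply: eq_bigr => k _; rewrite cmeanZ ?mxE 1?mulrC //; exact: cintg_expiM.
  by move=> k; apply: cintgZ; exact: cintg_expiM.
apply/funext => x; rewrite big_distrl big_distrr /=; apply: eq_bigr => k _.
by rewrite opprB expiD; ring.
Qed.

Lemma cmean_conj_trig_poly b h : cintg h ->
  cmean (fun x => conjc (trig_poly b x) * h x) =
  \sum_(k < N.+1) fcoef k%:Z h * conjc (b k 0).
Proof.
move=> ih; rewrite (_ : (fun x => _) = (fun x => \sum_(k < N.+1)
   conjc (b k 0) * (expi (- k%:Z) x * h x))).
  rewrite cmean_sum.
    by apply: eq_bigr => k _; rewrite cmeanZ 1?mulrC //; exact: cintg_expiM.
  by move=> k; apply: cintgZ; exact: cintg_expiM.
apply/funext => x; rewrite rmorph_sum big_distrl /=; apply: eq_bigr => k _.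
by rewrite -expiJ rmorphM mulrA.
Qed.

Lemma quadratic_mean b psi : intg psi ->
  mean (fun x => cabs (trig_poly b x) ^+ 2 * psi x) =
  Re (inner (fourier_mx N psi *m b) b).
Proof.
move=> ip; have ic := cintg_trig_polyM b (cintg_real ip).
have := cmean_conj_trig_poly b ic; rewrite /inner.
under [X in _ = X -> _]eq_bigr do rewrite fcoef_trig_polyM //.
move=> <- /=; congr mean; apply/funext => x.
by rewrite cabs2 !ReImE /=; ring.
Qed.

End TrigPoly.

(** * The explicit minimizer and its error *)

Section OptimalCharacteristic.
Context {R : realType}.
Variables (N : nat) (a : 'cV[R[i]]_N.+1) (f g : R -> R).
Hypotheses (df : spectral_density f) (dg : spectral_density g)
  (min_fg : minimality f g).
Local Notation Re := complex.Re.
Local Notation Im := complex.Im.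
Local Notation F := (fun x => f x + g x).
Local Notation A := (trig_poly a).
Local Notation C := (Cfun a f g).

Let f0 x : circle x -> 0 <= f x := df.1 x.
Let g0 x : circle x -> 0 <= g x := dg.1 x.
Let mf : measc f := intg_measc df.2.
Let mg : measc g := intg_measc dg.2.
Let mF : measc F := meascD mf mg.
Let iF : intg F := intg_total df dg.
Let F0 x : circle x -> 0 <= F x := @total_ge0 _ _ _ df dg x.
Let posF : ae_circle (fun x => 0 < F x) := (minimality_intg df dg min_fg).1.
Let iV : intg (fun x => (F x)^-1) := (minimality_intg df dg min_fg).2.

(** A kernel vector [c] makes the mean of [|trig_poly c|^2 / (f + g)] vanish, so [trig_poly c] is
    zero almost everywhere and its Fourier coefficients, the entries of [c], are zero. The
    transposes are there because [det0P] yields a left kernel vector. *)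
Lemma Bmx_unit : Bmx N f g \in unitmx.
Proof.
rewrite -unitmx_tr unitmxE unitfE; apply/det0P => -[v v0 vB].
have Bc : Bmx N f g *m v^T = 0 by rewrite -[LHS]trmxK trmx_mul trmxK vB trmx0.
case/eqP: v0; apply/trmx_inj; rewrite trmx0; set c := v^T in Bc *.
have := quadratic_mean c iV; rewrite -/(Bmx N f g) Bc.
rewrite /inner big1 => [/=|k _]; last by rewrite mxE mul0r.
have [M hM] := trig_poly_bounded c.
have mc := cmeasc_trig_poly c.
move=> /mean_eq0 h.
have C0 : ae_circle (fun x => trig_poly c x = 0).
  have i2 : intg (fun x => cabs (trig_poly c x) ^+ 2 * (F x)^-1).
    apply: (@intgM_bound _ _ _ M) => //; first exact: cmeasc_cabs2.
    by apply: ae_circle_all => x _; rewrite ger0_norm ?sqr_ge0.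
  have p2 : ae_circle (fun x => 0 <= cabs (trig_poly c x) ^+ 2 * (F x)^-1).
    by apply: ae_circle_all => x cx; rewrite mulr_ge0 ?invr_ge0 ?F0 // sqr_ge0.
  apply: ae_circle_imp2 posF (h i2 p2) => x _ Fx /eqP.
  by rewrite mulf_eq0 invr_eq0 (gt_eqF Fx) orbF => /eqP; exact: cabs2_eq0.
apply/colP => j; rewrite [RHS]mxE -fcoef_trig_poly /fcoef -[RHS](@cmean_cst R 0).
apply: cmean_eq; [|exact: cmeasc_cst|].
  by apply: cmeascM => //; exact: cmeasc_expi.
by apply: ae_circle_imp C0 => x _ ->; rewrite mulr0.
Qed.

Definition optimal_fun (x : R) : R[i] := (A x * (f x)%:C - C x) / (f x + g x)%:C.

Let intg_ratio : intg (fun x => f x / F x).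
Proof.
apply: (intg_le _ _ (intg_cst 1)); first by apply: meascM => //; exact: meascV.
apply: ae_circle_imp posF => x cx Fx.
by rewrite ger0_norm ?divr_ge0 ?f0 ?F0 // ler_pdivrMr // mul1r lerDl g0.
Qed.

Let intg_par : intg (fun x => f x * g x / F x).
Proof.
apply: (intg_le _ _ df.2); first by apply: meascM; [exact: meascM|exact: meascV].
apply: ae_circle_imp posF => x cx Fx.
have ? := f0 cx; have ? := g0 cx.
rewrite ger0_norm ?divr_ge0 ?mulr_ge0 ?F0 // ler_pdivrMr //.
by rewrite ler_wpM2l // lerDr.
Qed.

Lemma optimal_funE : optimal_fun =
  (fun x => A x * (f x / F x)%:C - C x * ((F x)^-1)%:C).
Proof.
by apply/funext => x; rewrite /optimal_fun -fmorphV /= mulrBl -mulrA -rmorphM.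
Qed.

Lemma cmeasc_optimal_fun : cmeasc optimal_fun.
Proof.
rewrite optimal_funE; apply: cmeascB; apply: cmeascM; try exact: cmeasc_trig_poly;
by apply: cmeasc_real; apply: intg_measc.
Qed.

(** [|A f - C|^2 / F <= 2 |A|^2 f^2 / F + 2 |C|^2 / F], where [f / F <= 1] and [1 / F] is integrable
    by minimality. *)
Lemma wL2_optimal_fun : wL2 F optimal_fun.
Proof.
have mh := cmeasc_optimal_fun; split=> //.
have [M hM] := trig_poly_bounded a.
have [M' hM'] := trig_poly_bounded (invmx (Bmx N f g) *m (Rmx N f g *m a)).
have iB : intg (fun x => 2 * M * f x + 2 * M' * (F x)^-1).
  by apply: intgD; apply: intgZ => //; exact: df.2.
apply: intg_le iB; first by apply: meascM => //; exact: cmeasc_cabs2.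
apply: ae_circle_imp posF => x cx Fx.
have ? := f0 cx; have ? := g0 cx.
rewrite ger0_norm ?(mulr_ge0 (sqr_ge0 _)) ?F0 //.
have hE : cabs (optimal_fun x) ^+ 2 * F x = cabs (A x * (f x)%:C - C x) ^+ 2 * (F x)^-1.
  rewrite /optimal_fun cabs2M -[_ ^+ 2 * _ * _]mulrA; congr (_ * _).
  rewrite -fmorphV cabs2 /= expr0n addr0 expr2; field; lra.
rewrite hE; have V0 : 0 < (F x)^-1 by rewrite invr_gt0.
have := cabs2D_le (A x * (f x)%:C) (- C x).
rewrite cabs2M -(mulN1r (C x)) cabs2M [cabs (- 1) ^+ 2]cabs2 [cabs (f x)%:C ^+ 2]cabs2 /=.
rewrite oppr0 expr0n /= !addr0 sqrrN expr1n mul1r !mulr2n => h.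
have h1 := ler_wpM2r (ltW V0) h; apply: le_trans h1 _; rewrite mulrDl; apply: lerD.
- have fF : f x * (F x)^-1 <= 1 by rewrite ler_pdivrMr // mul1r lerDl.
  have u1 : cabs (A x) ^+ 2 * f x <= M * f x by rewrite ler_wpM2r.
  have u0 : 0 <= cabs (A x) ^+ 2 * f x by rewrite mulr_ge0 ?sqr_ge0.
  have u2 := ler_wpM2l u0 fF.
  rewrite [leLHS](_ : _ = 2 * (cabs (A x) ^+ 2 * f x * (f x * (F x)^-1))); last by ring.
  lra.
- have := ler_wpM2r (ltW V0) (hM' x); rewrite -/C; lra.
Qed.

(** The coefficients of [A f / F] are [Rmx *m a] and those of [C / F] are
    [Bmx *m (invmx Bmx *m (Rmx *m a))]: the coefficients of [C] are chosen to make these cancel. *)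
Lemma fcoef_optimal_fun (j : 'I_N.+1) : fcoef j%:Z optimal_fun = 0.
Proof.
rewrite optimal_funE fcoefB; try by apply: cintg_trig_polyM; exact: cintg_real.
rewrite !fcoef_trig_polyM // -/(Bmx N f g) -/(Rmx N f g).
by rewrite mulKVmx ?subrr // Bmx_unit.
Qed.

(** The integrand of [Delta], with densities independent of those defining the section, so that one
    [k] can be tested at several pairs; it is affine in them. *)
Definition err (k : R -> R[i]) (f1 g1 : R -> R) x : R :=
  cabs (A x - k x) ^+ 2 * f1 x + cabs (k x) ^+ 2 * g1 x.

Lemma intg_err k : wL2 F k -> intg (err k f g) /\ Delta a k f g = (mean (err k f g))%:E.
Proof.
move=> wk; have [l Al] := trig_polyE a.
have [md iA] : wL2 F (fun x => A x - k x).
  by rewrite Al; apply: wL2B => //; exact: wL2_trigl.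
have [mk ik] := wk.
have i1 : intg (fun x => cabs (A x - k x) ^+ 2 * f x).
  apply: intg_le iA; first by apply: meascM => //; exact: cmeasc_cabs2.
  apply: ae_circle_all => x cx; rewrite ger0_norm ?(mulr_ge0 (sqr_ge0 _)) ?f0 //.
  by rewrite ler_wpM2l ?sqr_ge0 // lerDl g0.
have i2 : intg (fun x => cabs (k x) ^+ 2 * g x).
  apply: intg_le ik; first by apply: meascM => //; exact: cmeasc_cabs2.
  apply: ae_circle_all => x cx; rewrite ger0_norm ?(mulr_ge0 (sqr_ge0 _)) ?g0 //.
  by rewrite ler_wpM2l ?sqr_ge0 // lerDr f0.
split; first exact: intgD.
by rewrite /Delta !emean_intg // -EFinD -meanD.
Qed.

(** Since [A - h = (A g + C) / F], the cross terms cancel and the integrand is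
    [|C|^2 / F + |A|^2 f g / F]. Its two terms are the quadratic forms of [Bmx] and [Qmx]. *)
Lemma mean_err_optimal_fun :
  mean (err optimal_fun f g) = Re (objective a f g).
Proof.
set c := invmx (Bmx N f g) *m (Rmx N f g *m a).
have BC : Bmx N f g *m c = Rmx N f g *m a by rewrite /c mulKVmx // Bmx_unit.
rewrite /objective ReD -/c -{1}BC -!quadratic_mean //.
have hb b psi : intg psi -> intg (fun x => cabs (trig_poly b x) ^+ 2 * psi x).
  move=> ip; have [M hM] := trig_poly_bounded b.
  apply: (@intgM_bound _ _ _ M) => //; first by apply: cmeasc_cabs2; exact: cmeasc_trig_poly.
  by apply: ae_circle_all => x _; rewrite ger0_norm ?sqr_ge0.
rewrite -meanD; [|exact: hb|exact: hb].
have [ie _] := intg_err wL2_optimal_fun.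
apply: mean_eq; [exact: intg_measc|by apply: intg_measc; apply: intgD; exact: hb|].
apply: ae_circle_imp posF => x cx Fx.
have Fn : f x + g x != 0 by rewrite gt_eqF.
rewrite /err optimal_funE -/C /Cfun -/c !cabs2 !ReImE /=.
by field.
Qed.

(* Orthogonality of [k - optimal_fun] to [C]; the cross terms of the error are
   [-2 Re (conjc C * (k - optimal_fun))]. *)
Lemma err_pythagoras k : wL2 F k -> (forall j : 'I_N.+1, fcoef j%:Z k = 0) ->
  mean (err k f g) =
  Re (objective a f g) + wnorm2 F (fun x => k x - optimal_fun x).
Proof.
move=> wk k0; rewrite -mean_err_optimal_fun; have wh := wL2_optimal_fun.
have [ik _] := intg_err wk; have [ih _] := intg_err wh.
have wd : wL2 F (fun x => k x - optimal_fun x) by exact: wL2B.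
case: (wd) => md id.
have cint h : wL2 F h -> cintg h by move=> [mh ih']; exact: (cintg_weight mh ih' iV posF).
have cd := cint _ wd.
pose c := invmx (Bmx N f g) *m (Rmx N f g *m a).
have z : cmean (fun x => conjc (C x) * (k x - optimal_fun x)) = 0.
  rewrite cmean_conj_trig_poly // big1 // => j _.
  by rewrite fcoefB ?k0 ?fcoef_optimal_fun ?subrr ?mul0r //; exact: cint.
have z' : mean (fun x => Re (conjc (C x) * (k x - optimal_fun x))) = 0.
  by have := congr1 (fun w => Re w) z.
have ic : intg (fun x => Re (conjc (C x) * (k x - optimal_fun x))).
  have : cintg (fun x => conjc (C x) * (k x - optimal_fun x)); last by case.
  rewrite (_ : (fun x => _) = (fun x => conjc (C x * conjc (k x - optimal_fun x)))).
    by apply: cintgJ; apply: cintg_trig_polyM; exact: cintgJ.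
  by apply/funext => x; rewrite rmorphM /= conjcK.
rewrite /wnorm2 -meanD // -[RHS](subr0) -(mulr0 2) -z' -meanZ // -meanB; last exact: intgZ;
  last first.
  exact: intgD.
apply: mean_eq.
- exact: intg_measc.
- by apply: intg_measc; apply: intgB; [exact: intgD|exact: intgZ].
apply: ae_circle_imp posF => x cx Fx.
have Fn : f x + g x != 0 by rewrite gt_eqF.
rewrite /err optimal_funE !cabs2 !ReImE /=.
by field.
Qed.

End OptimalCharacteristic.

(** * The saddle point *)

Section Saddle.
Context {R : realType}.
Local Notation Re := complex.Re.
Local Notation Im := complex.Im.

Definition mix (t : R) (p q : R -> R) x := (1 - t) * p x + t * q x.

(** The difference of the two sides is [s^-1 |s z - w|^2]. Unlike in [cabs2D_le], the factor of
    [|z|^2] tends to 1 with [s], which a sharp limit requires. *)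
Lemma cabs2D_weighted (z w : R[i]) (s : R) : 0 < s ->
  cabs (z + w) ^+ 2 <= (1 + s) * cabs z ^+ 2 + (1 + s^-1) * cabs w ^+ 2.
Proof.
move=> s0; rewrite !cabs2 !ReImE -subr_ge0.
have h : 0 <= s^-1 * ((s * Re z - Re w) ^+ 2 + (s * Im z - Im w) ^+ 2).
  by rewrite mulr_ge0 ?invr_ge0 ?(ltW s0) // addr_ge0 ?sqr_ge0.
apply: le_trans h _; rewrite le_eqVlt; apply/orP; left; apply/eqP.
by field; lra.
Qed.

Lemma le_vanishing (x m c : R) :
  (forall s, 0 < s <= 2^-1 -> x <= m + s * c) -> x <= m.
Proof.
move=> h; apply/ler_addgt0Pr => e e0.
have c1 : 0 < `|c| + 1 by rewrite ltr_wpDl.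
pose s := Num.min 2^-1 (e / (`|c| + 1)).
have s0 : 0 < s by rewrite lt_min divr_gt0 // invr_gt0 ltr0n.
have s1 : s <= 2^-1 by rewrite ge_min lexx.
have s2 : s <= e / (`|c| + 1) by rewrite ge_min lexx orbT.
apply: le_trans (h s _) _; first by rewrite s0.
rewrite lerD2l; move: s2; rewrite ler_pdivlMr // => s2; apply: le_trans s2.
by rewrite ler_pM2l //; have := ler_norm c; lra.
Qed.

Lemma spectral_density_mix (t : R) p q : 0 <= t <= 1 ->
  spectral_density p -> spectral_density q -> spectral_density (mix t p q).
Proof.
move=> /andP[t0 t1] [p0 p1] [q0 q1]; split.
  by move=> x cx; rewrite addr_ge0 // mulr_ge0 ?p0 ?q0 // subr_ge0.
by apply: intgD; exact: intgZ.
Qed.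

Lemma mean_mix (t : R) p q : intg p -> intg q ->
  mean (mix t p q) = (1 - t) * mean p + t * mean q.
Proof. by move=> ip iq; rewrite meanD ?meanZ //; exact: intgZ. Qed.

Lemma wL2_dominated (W W' : R -> R) (c : R) h : measc W' -> wL2 W h ->
  (forall x, circle x -> 0 <= W' x <= c * W x) -> wL2 W' h.
Proof.
move=> mW' [mh ih] WW; split=> //; apply: intg_le (intgZ c ih).
  by apply: meascM => //; exact: cmeasc_cabs2.
apply: ae_circle_all => x cx; have /andP[w0 w1] := WW x cx.
rewrite ger0_norm ?(mulr_ge0 (sqr_ge0 _)) // [leRHS]mulrCA.
by rewrite ler_wpM2l ?sqr_ge0.
Qed.

Variables (N : nat) (a : 'cV[R[i]]_N.+1) (f0 g0 f g : R -> R).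
Hypotheses (df0 : spectral_density f0) (dg0 : spectral_density g0)
  (df : spectral_density f) (dg : spectral_density g)
  (min0 : minimality f0 g0).
Local Notation F0 := (fun x => f0 x + g0 x).
Local Notation F := (fun x => f x + g x).
Local Notation h0 := (optimal_fun a f0 g0).
Local Notation m := (Re (objective a f0 g0)).

Lemma err_mix k (t : R) : err a k (mix t f0 f) (mix t g0 g) =
  mix t (err a k f0 g0) (err a k f g).
Proof. by apply/funext => x; rewrite /err /mix; ring. Qed.

Lemma minimality_mix (t : R) : 0 < t < 1 -> minimality (mix t f0 f) (mix t g0 g).
Proof.
move=> /andP[t0 t1]; have [pos iV] := minimality_intg df0 dg0 min0.
have t01 : 0 <= t <= 1 by lra.
have iFt := intg_total (spectral_density_mix t01 df0 df) (spectral_density_mix t01 dg0 dg).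
have le : ae_circle (fun x => 0 < (1 - t) * F0 x <= mix t f0 f x + mix t g0 g x).
  apply: ae_circle_imp pos => x cx Fx; rewrite mulr_gt0 //= ?subr_gt0 //.
  have : 0 <= t * F x by rewrite mulr_ge0 ?(ltW t0) // total_ge0.
  by rewrite /mix; lra.
apply: intg_minimality; first exact: intg_measc.
  by apply: ae_circle_imp le => x _ /andP[]; exact: lt_le_trans.
apply: intg_le (intgZ (1 - t)^-1 iV); first by apply: meascV; exact: intg_measc.
apply: ae_circle_imp le => x _ /andP[l1 l2].
have l3 := lt_le_trans l1 l2.
by rewrite ger0_norm ?invr_ge0 ?(ltW l3) // -invfM lef_pV2.
Qed.

Lemma err_ge0 k f1 g1 : spectral_density f1 -> spectral_density g1 ->
  forall x, circle x -> 0 <= err a k f1 g1 x.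
Proof.
move=> [f1_ge0 _] [g1_ge0 _] x cx.
by rewrite /err addr_ge0 // mulr_ge0 ?sqr_ge0 ?f1_ge0 ?g1_ge0.
Qed.

(* The optimal characteristic along the segment from [(f0, g0)] to [(f, g)]
   is good for [(f, g)] and close to [h0]. *)
Lemma mix_optimal_fun (t : R) : 0 < t < 1 ->
  Re (objective a (mix t f0 f) (mix t g0 g)) <= m ->
  exists k, [/\ wL2 F0 k, wL2 F k, mean (err a k f g) <= m &
    (1 - t) * wnorm2 F0 (fun x => k x - h0 x) <= t * m].
Proof.
move=> t01 obj; have /andP[t0 t1] := t01.
have t01' : 0 <= t <= 1 by lra.
have dft := spectral_density_mix t01' df0 df.
have dgt := spectral_density_mix t01' dg0 dg.
have mt := minimality_mix t01.
have wk := wL2_optimal_fun a dft dgt mt.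
set k := optimal_fun _ _ _ in wk.
have k0 (j : 'I_N.+1) : fcoef j%:Z k = 0 := fcoef_optimal_fun a dft dgt mt j.
have FtE x : mix t f0 f x + mix t g0 g x = (1 - t) * F0 x + t * F x.
  by rewrite /mix; ring.
have u0 : 0 < 1 - t by lra.
have w0 : wL2 F0 k.
  apply: (@wL2_dominated _ _ (1 - t)^-1 _ _ wk).
    by apply: intg_measc; exact: intg_total.
  move=> x cx; rewrite total_ge0 //= mulrC ler_pdivlMr // FtE mulrC lerDl.
  by rewrite mulr_ge0 ?(ltW t0) // total_ge0.
have w1 : wL2 F k.
  apply: (@wL2_dominated _ _ t^-1 _ _ wk).
    by apply: intg_measc; exact: intg_total.
  move=> x cx; rewrite total_ge0 //= mulrC ler_pdivlMr // FtE mulrC lerDr.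
  by rewrite mulr_ge0 ?(ltW u0) // total_ge0.
exists k.
have [i0 _] := intg_err a df0 dg0 w0; have [i1 _] := intg_err a df dg w1.
have E := mean_err_optimal_fun a dft dgt mt; rewrite -/k err_mix mean_mix // in E.
have P := err_pythagoras a df0 dg0 min0 w0 k0.
have wd : wL2 F0 (fun x => k x - h0 x).
  by apply: wL2B => //; [exact: intg_total|exact: total_ge0|exact: wL2_optimal_fun].
have D0 := wnorm2_ge0 (total_ge0 df0 dg0) wd.
have E0 : 0 <= mean (err a k f g).
  by apply: mean_ge0 => //; apply: ae_circle_all; exact: err_ge0.
(* With [d] the squared distance from [k] to [h0] and [e] the error of [k] at [(f, g)], this gives
   [(1 - t) (m + d) + t e <= m]. Discarding [t e >= 0] bounds [d]; discarding [(1 - t) d >= 0]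
   bounds [e]. *)
rewrite P in E; rewrite -E in obj.
set d := wnorm2 _ _ in obj D0 *; set e := mean _ in obj E0 *.
split=> //; last first.
  by have := mulr_ge0 (ltW t0) E0; lra.
rewrite -(ler_pM2l t0); have := mulr_ge0 (ltW u0) D0; lra.
Qed.

(** Boundedness places [h0] in L2(f + g), so its error at [(f, g)] is integrable and can serve as
    majorant when the cutoff is removed. *)
Lemma saddle_point (M : R) :
  ae_circle (fun x => cabs (h0 x) ^+ 2 <= M) ->
  (forall t, 0 < t < 1 -> Re (objective a (mix t f0 f) (mix t g0 g)) <= m) ->
  mean (err a h0 f g) <= m.
Proof.
move=> hM obj; have [pos iV] := minimality_intg df0 dg0 min0.
have iF := intg_total df dg; have iF0 := intg_total df0 dg0.
have mh := cmeasc_optimal_fun a df0 dg0 min0.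
have wh0 : wL2 F0 h0 by exact: wL2_optimal_fun.
have wh : wL2 F h0 by exact: (wL2_bounded iF mh hM).
have [ie _] := intg_err a df dg wh.
have m0 : 0 <= m.
  rewrite -mean_err_optimal_fun //; have [i0 _] := intg_err a df0 dg0 wh0.
  by apply: mean_ge0 => //; apply: ae_circle_all; exact: err_ge0.
(* Multiplying by [kappa n <= 1] makes [f + g] bounded by [n (f0 + g0)]. *)
pose kappa (n : nat) x := n%:R * F0 x / (F x + n%:R * F0 x).
have kapP n x : circle x -> 0 < F0 x -> 0 <= kappa n x <= 1 /\
    kappa n x * F x <= n%:R * F0 x.
  move=> cx Fx; have Fge := total_ge0 df dg cx.
  have n0 : 0 <= n%:R * F0 x by rewrite mulr_ge0 ?(ltW Fx).
  rewrite /kappa; have [z|nz] := eqVneq (F x + n%:R * F0 x) 0.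
    by rewrite z invr0 mulr0 mul0r lexx ler01.
  have p : 0 < F x + n%:R * F0 x by rewrite lt_neqAle eq_sym nz addr_ge0.
  rewrite divr_ge0 ?(ltW p) //= ler_pdivrMr // mul1r lerDr; split=> //.
  by rewrite mulrAC ler_pdivrMr // ler_wpM2l // lerDl.
have mkap n : measc (kappa n).
  apply: meascM.
    by apply: meascM; [exact: measc_cst|exact: intg_measc].
  apply: meascV; apply: meascD; first exact: intg_measc.
  by apply: meascM; [exact: measc_cst|exact: intg_measc].
have ikap n p : intg p -> intg (fun x => kappa n x * p x).
  move=> ip; apply: (@intgM_bound _ _ _ 1) => //.
  apply: ae_circle_imp pos => x cx Fx; have [/andP[k0 k1] _] := kapP n x cx Fx.
  by rewrite ger0_norm.
have bound n : mean (fun x => kappa n x * err a h0 f g x) <= m.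
  (* With [t = s^2] one has [d <= 2 s^2 m], and the bound is [(1 + s) m + (1 + 1/s) n (2 s^2 m) = m
     + s m + (1 + s) (2 s n m)], at most [m + s (m + 4 n m)] because [1 + s <= 2]. *)
  apply: (@le_vanishing _ _ (m + 4 * n%:R * m)) => s /andP[s0 s1].
  have t01 : 0 < s ^+ 2 < 1 by rewrite exprn_gt0 //= expr_lt1 //; lra.
  have t1 : s ^+ 2 <= 2^-1.
    by rewrite expr2; have := ler_pM (ltW s0) (ltW s0) s1 s1; lra.
  have [k [w0 w1 e1 dd]] := mix_optimal_fun t01 (obj _ t01).
  set d := wnorm2 _ _ in dd.
  have [ike _] := intg_err a df dg w1.
  have wd : wL2 F0 (fun x => k x - h0 x).
    by apply: wL2B => //; exact: total_ge0.
  have d0 : 0 <= d := wnorm2_ge0 (total_ge0 df0 dg0) wd.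
  have step : mean (fun x => kappa n x * err a h0 f g x) <=
      (1 + s) * mean (err a k f g) + (1 + s^-1) * n%:R * d.
    case: (wd) => _ id; rewrite /d /wnorm2 -!meanZ // -meanD; try exact: intgZ.
    apply: mean_le; [exact: ikap|by apply: intgD; exact: intgZ|].
    apply: ae_circle_imp pos => x cx Fx.
    have [/andP[k0 k1] kF] := kapP n x cx Fx.
    have fx := df.1 x cx; have gx := dg.1 x cx.
    (* The splittings are [A - h0 = (A - k) + (k - h0)] and [h0 = k - (k - h0)]; weighted by [f] and
       [g], the remainders add up to a multiple of [|k - h0|^2 F], which the cutoff compares with
       [F0]. *)
    have a1 := cabs2D_weighted (trig_poly a x - k x) (k x - h0 x) s0.
    have a2 := cabs2D_weighted (k x) (- (k x - h0 x)) s0.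
    rewrite -(mulN1r (_ - _)) cabs2M [cabs (-1) ^+ 2]cabs2 /= oppr0 expr0n addr0
      sqrrN expr1n mul1r mulN1r in a2.
    rewrite (_ : _ + _ = trig_poly a x - h0 x) in a1; last by ring.
    rewrite (_ : _ - (_ - _) = h0 x) in a2; last by ring.
    have b1 := ler_wpM2r fx a1; have b2 := ler_wpM2r gx a2.
    set q := cabs (k x - h0 x) ^+ 2 in b1 b2 *.
    have q0 : 0 <= (1 + s^-1) * q.
      by rewrite mulr_ge0 ?sqr_ge0 // addr_ge0 // invr_ge0 ltW.
    have e0 : 0 <= err a k f g x by exact: err_ge0.
    have le1 : err a h0 f g x <= (1 + s) * err a k f g x + (1 + s^-1) * q * F x.
      by rewrite /err; lra.
    apply: le_trans (ler_wpM2l k0 le1) _; rewrite mulrDr; apply: lerD.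
      by apply: ler_piMl => //; rewrite mulr_ge0 //; lra.
    rewrite mulrCA; apply: le_trans (ler_wpM2l q0 kF) _.
    by rewrite le_eqVlt; apply/orP; left; apply/eqP; ring.
  apply: le_trans step _.
  (* From [(1 - t) d <= t m] and [t <= 1/2]. *)
  have d2 : d <= 2 * s ^+ 2 * m.
    have : 0 <= (2^-1 - s ^+ 2) * d by rewrite mulr_ge0 // subr_ge0.
    lra.
  have c1 : (1 + s) * mean (err a k f g) <= (1 + s) * m by rewrite ler_wpM2l //; lra.
  have c2 : (1 + s^-1) * n%:R * d <= (1 + s^-1) * n%:R * (2 * s ^+ 2 * m).
    by apply: ler_wpM2l => //; rewrite mulr_ge0 // addr_ge0 // invr_ge0 ltW.
  have c3 : (1 + s^-1) * n%:R * (2 * s ^+ 2 * m) = (s + 1) * (2 * s * n%:R * m).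
    by field; lra.
  have c4 : (s + 1) * (2 * s * n%:R * m) <= 2 * (2 * s * n%:R * m).
    apply: ler_wpM2r; last by lra.
    by rewrite !mulr_ge0 // ltW.
  lra.
have cv : (fun n => mean (fun x => kappa n x * err a h0 f g x)) @ \oo -->
    mean (err a h0 f g).
  apply: (@mean_dominated _ _ _ (err a h0 f g)) => //.
  - by move=> n; apply: intg_measc; exact: ikap.
  - exact: intg_measc.
  - apply: ae_circle_imp pos => x cx Fx.
    rewrite -[X in _ --> X](mul1r (err a h0 f g x)).
    apply: cvgM; last exact: cvg_cst.
    have Fge := total_ge0 df dg cx.
    (* The index is shifted because at [n = 0] the denominator is [F x], which may vanish, and the
       identity then fails. *)
    have E n : kappa n.+1 x = 1 - (F x / (F x + n.+1%:R * F0 x)).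
      rewrite /kappa; field.
      by rewrite gt_eqF // ltr_wpDl // mulr_gt0.
    rewrite -(cvg_shiftS (fun n => kappa n x)); under eq_fun do rewrite E.
    suff c : (fun n => 1 - F x / (F x + n.+1%:R * F0 x)) @ \oo --> (1 - 0 : R).
      by rewrite subr0 in c.
    apply: cvgB; first exact: cvg_cst.
    have hh : (fun n => (F x / F0 x) * n.+1%:R^-1) @ \oo --> (F x / F0 x) * 0.
      by apply: cvgM; [exact: cvg_cst|exact: cvg_harmonic].
    rewrite mulr0 in hh.
    apply: (squeeze_cvgr _ (cvg_cst (0 : R)) hh); apply: nearW => n.
    have p : 0 < n.+1%:R * F0 x by rewrite mulr_gt0.
    have q : 0 < F x + n.+1%:R * F0 x by rewrite ltr_wpDl.
    apply/andP; split; first by rewrite divr_ge0 // ltW.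
    rewrite -[leRHS]mulrA -invfM ler_wpM2l //.
    by rewrite (mulrC (f0 x + g0 x)) lef_pV2 ?posrE // lerDr.
  - apply: ae_circle_imp pos => x cx Fx n; have [/andP[k0 k1] _] := kapP n x cx Fx.
    have e0 : 0 <= err a h0 f g x by exact: err_ge0.
    by rewrite ger0_norm ?(mulr_ge0 k0 e0) // ler_piMl.
rewrite -(cvg_lim _ cv) //; apply: limr_le; first by apply/cvg_ex; exists (mean (err a h0 f g)).
exact: nearW.
Qed.

End Saddle.

(** * Convexity of the density classes *)

Section Convexity.
Context {R : realType}.

Lemma Dvu_mix (v u : R -> R) (P1 t : R) f0 f : 0 <= t <= 1 ->
  Dvu v u P1 f0 -> Dvu v u P1 f -> Dvu v u P1 (mix t f0 f).
Proof.
move=> t01 [d0 b0 m0] [d b m1]; have /andP[t0 t1] := t01; split.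
- exact: spectral_density_mix.
- apply: ae_circle_imp2 b0 b => x _ /andP[l0 u0] /andP[l1 u1].
  have t1' : 0 <= 1 - t by lra.
  have := ler_wpM2l t1' l0; have := ler_wpM2l t1' u0.
  have := ler_wpM2l t0 l1; have := ler_wpM2l t0 u1; rewrite /mix; lra.
- rewrite (mean_mix _ d0.2 d.2).
  have t1' : 0 <= 1 - t by lra.
  have := ler_wpM2l t1' m0; have := ler_wpM2l t0 m1; lra.
Qed.

Lemma Deps_mix (eps : R) (g1 : R -> R) (P2 t : R) g0 g : 0 <= t <= 1 ->
  Deps eps g1 P2 g0 -> Deps eps g1 P2 g -> Deps eps g1 P2 (mix t g0 g).
Proof.
move=> t01 [d0 [w0 dw0 b0] m0] [d [w dw b] m1]; have /andP[t0 t1] := t01; split.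
- exact: spectral_density_mix.
- exists (mix t w0 w); first exact: spectral_density_mix.
  by apply: ae_circle_imp2 b0 b => x _ e0 e1; rewrite /mix e0 e1; ring.
- rewrite (mean_mix _ d0.2 d.2).
  have t1' : 0 <= 1 - t by lra.
  have := ler_wpM2l t1' m0; have := ler_wpM2l t0 m1; lra.
Qed.

End Convexity.

Theorem theorem7p5 (R : realType) (N : nat) (a : 'cV[R[i]]_N.+1)
  (P1 P2 eps : R) (v u g1 f0 g0 gamma1 gamma2 phi : R -> R)
  (alpha1 alpha2 : R)
  (P1_gt0 : 0 < P1) (P2_gt0 : 0 < P2) (eps_gt0 : 0 < eps) (eps_lt1 : eps < 1)
  (v_density : spectral_density v) (u_density : spectral_density u)
  (g1_density : spectral_density g1)
  (v_bounded : ae_bounded v) (u_bounded : ae_bounded u)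
  (D := Dvu v u P1 `*` Deps eps g1 P2)
  (A := trig_poly a) (C0 := Cfun a f0 g0)
  (hf := fun x => cabs (A x * (g0 x)%:C + C0 x) ^+ 2 / (f0 x + g0 x) ^+ 2)
  (hg := fun x => cabs (A x * (f0 x)%:C - C0 x) ^+ 2 / (f0 x + g0 x) ^+ 2)
  (h0 := fun x => (A x * (f0 x)%:C - C0 x) / (f0 x + g0 x)%:C)
  (f0_in : Dvu v u P1 f0) (g0_in : Deps eps g1 P2 g0)
  (f0g0_minimal : minimality f0 g0)
  (hf_bounded : ae_bounded hf) (hg_bounded : ae_bounded hg)
  (alpha1_gt0 : 0 < alpha1) (alpha2_gt0 : 0 < alpha2)
  (gamma1_le0 : ae_circle (fun x => gamma1 x <= 0))
  (gamma1_eq0 : ae_circle (fun x => v x < f0 x -> gamma1 x = 0))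
  (gamma2_ge0 : ae_circle (fun x => 0 <= gamma2 x))
  (gamma2_eq0 : ae_circle (fun x => f0 x < u x -> gamma2 x = 0))
  (phi_le0 : ae_circle (fun x => phi x <= 0))
  (phi_eq0 : ae_circle (fun x => (1 - eps) * g1 x < g0 x -> phi x = 0))
  (eq_f : ae_circle (fun x => cabs (A x * (g0 x)%:C + C0 x) =
            (f0 x + g0 x) * (gamma1 x + gamma2 x + alpha1^-1)))
  (eq_g : ae_circle (fun x => cabs (A x * (f0 x)%:C - C0 x) =
            (f0 x + g0 x) * (phi x + alpha2^-1)))
  (f0g0_maximal :
     is_max [set objective a fg.1 fg.2 |
              fg in [set fg | D fg /\ minimality fg.1 fg.2]]
            (objective a f0 g0)) :
  least_favourable a D f0 g0 /\ minimax_robust a D h0.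
Proof.
have [df0 _ _] := f0_in; have [dg0 _ _] := g0_in.
have h0E : h0 = optimal_fun a f0 g0 by [].
have [M hM] := hg_bounded.
(* [hg] is the squared modulus of [h0]. *)
have bnd : ae_circle (fun x => cabs (h0 x) ^+ 2 <= M).
  apply: ae_circle_imp hM => x _; apply: le_trans; apply: le_trans (ler_norm _).
  rewrite /hg /h0 cabs2M -fmorphV [X in _ * X]cabs2 /= expr0n addr0.
  by rewrite exprVn.
have mh := cmeasc_optimal_fun a df0 dg0 f0g0_minimal.
have hc (j : 'I_N.+1) : fcoef j%:Z h0 = 0 := fcoef_optimal_fun a df0 dg0 f0g0_minimal j.
have hL f g : spectral_density f -> spectral_density g -> L2N N f g h0.
  by move=> df dg; exact: (L2N_bounded df dg mh bnd hc).
pose m := complex.Re (objective a f0 g0).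
have wh0 := wL2_optimal_fun a df0 dg0 f0g0_minimal.
have Dh0 : Delta a h0 f0 g0 = m%:E.
  by rewrite h0E (intg_err a df0 dg0 wh0).2 mean_err_optimal_fun.
have low k : L2N N f0 g0 k -> (m%:E <= Delta a k f0 g0)%E.
  move=> /(L2N_admissible df0 dg0 f0g0_minimal) [wk k0].
  rewrite (intg_err a df0 dg0 wk).2 lee_fin err_pythagoras // lerDl.
  apply: wnorm2_ge0; first exact: total_ge0.
  by apply: wL2B => //; [exact: intg_total|exact: total_ge0].
have up f g : D (f, g) -> (Delta a h0 f g <= m%:E)%E.
  move=> [/= f_in g_in]; have [df _ _] := f_in; have [dg _ _] := g_in.
  have wh : wL2 (fun x => f x + g x) h0.
    exact: (wL2_bounded (intg_total df dg) mh bnd).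
  rewrite (intg_err a df dg wh).2 lee_fin.
  apply: (saddle_point df0 dg0 df dg f0g0_minimal bnd) => t t01.
  have /andP[t0 t1] := t01; have t01' : 0 <= t <= 1 by rewrite !ltW.
  have [_ ub] := f0g0_maximal.
  have : objective a (mix t f0 f) (mix t g0 g) <= objective a f0 g0.
    apply: ub; exists (mix t f0 f, mix t g0 g) => //; split.
      by split; [exact: Dvu_mix|exact: Deps_mix].
    exact: minimality_mix.
  (* The order of [R[i]] compares real parts between numbers of equal imaginary part. *)
  by rewrite lecE => /andP[].
have Din : D (f0, g0) by [].
have opt : optimal_char a f0 g0 h0.
  split; first exact: hL.
  split; first by exists h0 => //; exact: hL.
  by move=> _ [k hk <-]; rewrite Dh0; exact: low.
split.
- split=> //; exists h0 => //; split; first by exists f0, g0, h0.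
  move=> _ [f [g [k [fgD [kL [_ kmin]] ->]]]]; rewrite Dh0.
  (* [h0] lies in [L2N N f g], so it competes with the minimizer [k], whose error is therefore at
     most that of [h0]. *)
  apply: le_trans (up _ _ fgD); apply: kmin; exists h0 => //.
  by case: fgD => -[? _ _] [? _ _]; exact: hL.
- have hD : HD N D h0 by move=> [f g] [[? _ _] [? _ _]]; exact: hL.
  split=> //; split; first by exists h0.
  (* The worst error of [h0] is at most [m], which is at most the error of [k] at [(f0, g0)], hence
     at most the worst error of [k]. *)
  move=> _ [k kD <-]; apply: (@le_trans _ _ m%:E).
    by apply: ge_ereal_sup => _ [[f g] fgD <-]; exact: up.
  apply: le_trans (low _ (kD _ Din)) _.
  by apply: ereal_sup_ubound; exists (f0, g0).
Qed.
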